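(* Let $d\ge1$, let $A,B$ be finite alphabets, let $p$ be a probability vector on $A$ and $q$ a probability vector on $B$, and let $X\sim\mu=p^{\mathbb{Z}^d}$ and $Y\sim\nu=q^{\mathbb{Z}^d}$ be the corresponding i.i.d. $\mathbb{Z}^d$-processes, of equal entropy $h=h(p)=h(q)$. Suppose that for some constant $c>0$ there is a homomorphism $\phi$ with $\phi(X)=Y$ whose coding radius satisfies $\mathbf{P}[R_\phi>n]=O(e^{-cn})$ as $n\to\infty$. Then $p=q$ up to a permutation of the symbols (equivalently, the random variables $\log p(X_0)^{-1}$ and $\log q(Y_0)^{-1}$ have the same distribution, i.e. the multisets of nonzero probabilities of $p$ and of $q$ coincide).
   Context: For a finite probability vector $p$ on $A$, the entropy is $h(p)=-\sum_{a\in A}p_a\log p_a$. A homomorphism (factor map) $\phi:X\to Y$ is a measurable map $\phi:A^{\mathbb{Z}^d}\to B^{\mathbb{Z}^d}$, defined $\mu$-a.e., that commutes with the $\mathbb{Z}^d$-shifts and satisfies $\phi_*\mu=\nu$. With $B(0,n)=[-n,n]^d\subset\mathbb{Z}^d$, the coding radius of $\phi$ is the random variable $R_\phi(x)=\min\{n\in\mathbb{N}\cup\{\infty\}: \text{for }\mu\text{-a.e. } a,\ (a_i)_{i\in B(0,n)}=(x_i)_{i\in B(0,n)}\Rightarrow \phi(a)_0=\phi(x)_0\}$. *)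

(* Defs.v *)
From HB Require Import structures.
From mathcomp Require Import all_boot all_order all_algebra.
From mathcomp Require Import all_classical all_reals all_analysis.
Set Implicit Arguments. Unset Strict Implicit. Unset Printing Implicit Defensive.
Import Order.TTheory GRing.Theory Num.Theory.
Local Open Scope classical_set_scope.
Local Open Scope ring_scope.

Notation Zd d := 'rV[int]_d.

(* Configurations A^{Z^d}; a0 is an (irrelevant) inhabitant of A, only used
   to equip the configuration space with the pointedType structure required
   by MathComp-Analysis' measurable spaces. *)
Definition cfg (d : nat) (A : finType) (a0 : A) : Type := Zd d -> A.
HB.instance Definition _ d (A : finType) (a0 : A) :=
  Choice.copy (@cfg d A a0) (Zd d -> A).
HB.instance Definition _ d (A : finType) (a0 : A) :=
  isPointed.Build (cfg d a0) (fun _ => a0).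

Definition cyl (d : nat) (A : finType) (a0 : A) : set (set (cfg d a0)) :=
  [set C | exists (i : Zd d) (a : A), C = [set x | x i = a]].

Definition Cfg (d : nat) (A : finType) (a0 : A) :=
  g_sigma_algebraType (@cyl d A a0).

Definition shift (d : nat) (A : Type) (v : Zd d) (x : Zd d -> A) : Zd d -> A :=
  fun u => x (u + v).

Definition ball0 (d n : nat) : set (Zd d) :=
  [set u | forall i : 'I_d, `|u ord0 i| <= n%:Z].

(* finite probability vectors and entropy h(p) = - sum p_a log p_a
   (with 0 log 0 = 0, automatic since 0 * _ = 0) *)
Definition prob_vec (R : realType) (A : finType) (p : A -> R) : Prop :=
  (forall a, 0 <= p a) /\ \sum_(a : A) p a = 1.

Definition entropy (R : realType) (A : finType) (p : A -> R) : R :=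
  - \sum_(a : A) p a * ln (p a).

Definition iid_measure (R : realType) (d : nat) (A : finType) (a0 : A)
    (p : A -> R) (mu : probability (Cfg d a0) R) : Prop :=
  forall (s : seq (Zd d)) (f : Zd d -> A), uniq s ->
    mu [set x : Cfg d a0 | forall i, i \in s -> x i = f i]
    = (\prod_(i <- s) p (f i))%:E.

Definition factor_map (R : realType) (d : nat) (A B : finType) (a0 : A) (b0 : B)
    (mu : probability (Cfg d a0) R) (nu : probability (Cfg d b0) R)
    (phi : Cfg d a0 -> Cfg d b0) : Prop :=
  [/\ measurable_fun setT phi,
      (forall v : Zd d, {ae mu, forall x : Cfg d a0,
          phi (shift v x) = shift v (phi x)})
    & (forall E : set (Cfg d b0), measurable E -> mu (phi @^-1` E) = nu E)].

Definition codes_within (R : realType) (d : nat) (A B : finType) (a0 : A) (b0 : B)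
    (mu : probability (Cfg d a0) R) (phi : Cfg d a0 -> Cfg d b0)
    (n : nat) (x : Cfg d a0) : Prop :=
  {ae mu, forall a : Cfg d a0,
     (forall i, @ball0 d n i -> a i = x i) -> phi a 0 = phi x 0}.

(* coding radius R_phi(x) in N ∪ {oo}, as an extended real
   (min of the empty set = +oo) *)
Definition coding_radius (R : realType) (d : nat) (A B : finType) (a0 : A) (b0 : B)
    (mu : probability (Cfg d a0) R) (phi : Cfg d a0 -> Cfg d b0)
    (x : Cfg d a0) : \bar R :=
  ereal_inf [set (n%:R)%:E | n in [set n : nat | codes_within mu phi n x]].

(* Main.v *)
From Pilot Require Import Defs.
From HB Require Import structures.
From mathcomp Require Import all_boot all_order all_algebra.
From mathcomp Require Import all_classical all_reals all_analysis.
From mathcomp Require Import ring lra zify.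
Import Order.TTheory GRing.Theory Num.Theory.
Local Open Scope classical_set_scope.
Local Open Scope ring_scope.
Set Implicit Arguments. Unset Strict Implicit. Unset Printing Implicit Defensive.

(** Write f = -log q - h and g = -log p - h for the centered information
functions.  It suffices that f(Y_0) and g(X_0) have the same moments.

Let phi_m be the block code of radius m that agrees with phi except on an event
of probability eps_m = O(exp(-c m)), and let D_u = f(phi_m(X)_u) - g(X_u).

First, changing the symbol X_0 does not change the sum of the D_u, up to an L1
error kappa_m which is also exponentially small.  Otherwise, tilting the law of
X near every point of a sparse lattice would give a positive density of E D_u
in the tilted law, while equality of entropies and the data processing
inequality bound the sum of E D_u over a large box from above by a boundary
term plus a small density.

Now run phi_m on X i.i.d. on the torus (Z/n)^d with n = O(m), and let F and G be
the sums of f(phi_m(X)_u) and of g(X_u).  Since no single coordinate influences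
F - G, this difference is exponentially small in L1.  Any k sites of the torus
lift to Z^d together with their windows, so their images under phi_m are
i.i.d. of law q up to O(eps_m).  Hence E F^k and E G^k are the k-th moments of
sums of n^d i.i.d. copies of f(Y_0) and of g(X_0), up to exponentially small
errors, and induction on k gives equality of the k-th moments. *)

(** * Finite product measures *)

Section ProductExpectation.
Variables (R : realType) (A : finType) (p : A -> R).

Definition upd (J : eqType) (x : J -> A) (i : J) (a : A) : J -> A :=
  fun j => if j == i then a else x j.

(** The conditional expectation given all coordinates other than [i]. Only one coordinate is summed
    over, so [J] may be infinite, for instance Z^d. *)
Definition avg (J : eqType) (i : J) (h : (J -> A) -> R) : (J -> A) -> R :=
  fun x => \sum_a p a * h (upd x i a).

Definition Ex (J : finType) (h : (J -> A) -> R) : R :=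
  \sum_(x : {ffun J -> A}) (\prod_i p (x i)) * h x.

Hypothesis p_ge0 : forall a, 0 <= p a.
Hypothesis p_sum1 : \sum_a p a = 1.

Lemma prodp_ge0 (J : finType) (x : J -> A) : 0 <= \prod_i p (x i).
Proof. by apply: prodr_ge0. Qed.

Lemma upd_upd (J : eqType) (x : J -> A) i a b : upd (upd x i a) i b = upd x i b.
Proof. by apply/funext => j; rewrite /upd; case: eqP. Qed.

Lemma updC (J : eqType) (x : J -> A) i j a b : i != j ->
  upd (upd x i a) j b = upd (upd x j b) i a.
Proof.
move=> ij; apply/funext => k; rewrite /upd.
case: (k =P j) => [->|//]; by rewrite eq_sym (negbTE ij).
Qed.

Section Fin.
Variable J : finType.
Implicit Types h g : (J -> A) -> R.

Lemma Ex_cst (e : R) : Ex (fun _ : J -> A => e) = e.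
Proof.
rewrite /Ex -mulr_suml -(bigA_distr_bigA (fun (_ : J) a => p a)).
by rewrite big1 ?mul1r.
Qed.

Lemma ExD h g : Ex (fun x => h x + g x) = Ex h + Ex g.
Proof. by rewrite /Ex -big_split /=; apply: eq_bigr => x _; rewrite mulrDr. Qed.

Lemma ExZ (e : R) h : Ex (fun x => e * h x) = e * Ex h.
Proof. by rewrite /Ex mulr_sumr; apply: eq_bigr => x _; rewrite mulrCA. Qed.

Lemma ExN h : Ex (fun x => - h x) = - Ex h.
Proof. by rewrite /Ex -sumrN; apply: eq_bigr => x _; rewrite mulrN. Qed.

Lemma ExB h g : Ex (fun x => h x - g x) = Ex h - Ex g.
Proof. by rewrite ExD ExN. Qed.

Lemma Ex_sum (I : finType) (P : pred I) (h : I -> (J -> A) -> R) :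
  Ex (fun x => \sum_(i | P i) h i x) = \sum_(i | P i) Ex (h i).
Proof.
rewrite /Ex exchange_big /=; apply: eq_bigr => x _; by rewrite mulr_sumr.
Qed.

Lemma ler_Ex h g : (forall x, h x <= g x) -> Ex h <= Ex g.
Proof.
by move=> hg; apply: ler_sum => x _; apply: ler_wpM2l => //; apply: prodp_ge0.
Qed.

Lemma eq_Ex h g : (forall x, h x = g x) -> Ex h = Ex g.
Proof. by move=> hg; apply: eq_bigr => x _; rewrite hg. Qed.

Lemma Ex_ge0 h : (forall x, 0 <= h x) -> 0 <= Ex h.
Proof. by move=> h0; apply: sumr_ge0 => x _; rewrite mulr_ge0 ?prodp_ge0. Qed.

Lemma ler_norm_Ex h : `|Ex h| <= Ex (fun x => `|h x|).
Proof.
apply: le_trans (ler_norm_sum _ _ _) _; apply: ler_sum => x _.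
by rewrite normrM ger0_norm ?prodp_ge0.
Qed.

(** Adjoin an independent symbol of law [p]. Exchanging it with the symbol at [i] is an involution
    that preserves the product weight. *)
Lemma Ex_avg (i : J) h : Ex (avg i h) = Ex h.
Proof.
pose swap (z : {ffun J -> A} * A) : {ffun J -> A} * A :=
  ([ffun j => upd z.1 i z.2 j], z.1 i).
have swapK : involutive swap.
  move=> [x a]; rewrite /swap /=; congr (_, _); last by rewrite ffunE /upd eqxx.
  apply/ffunP => j; rewrite ffunE /upd /=.
  by case: eqP => [->//|/eqP/negbTE E]; rewrite ffunE /upd E.
pose w (z : {ffun J -> A} * A) := (\prod_j p (z.1 j)) * p z.2.
have wswap z : w (swap z) = w z.
  rewrite /w /= (bigD1 i) //= [in RHS](bigD1 i) //= ffunE /upd eqxx.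
  rewrite mulrAC [RHS]mulrAC; congr (_ * _); first by rewrite mulrC.
  by apply: eq_bigr => j /negbTE ji; rewrite ffunE ji.
transitivity (\sum_z w z * h (swap z).1).
  rewrite -(pair_bigA _ (fun x a => w (x, a) * h (swap (x, a)).1)) /=.
  apply: eq_bigr => x _; rewrite mulr_sumr; apply: eq_bigr => a _.
  rewrite mulrA; congr (_ * h _); by apply/funext => j; rewrite ffunE.
rewrite (reindex_inj (inv_inj swapK)).
transitivity (\sum_z w z * h z.1).
  by apply: eq_bigr => z _; rewrite wswap swapK.
rewrite -(pair_bigA _ (fun x a => w (x, a) * h x)) /=.
by apply: eq_bigr => x _; rewrite -mulr_suml /w /= -mulr_sumr p_sum1 mulr1.
Qed.

Lemma Ex_indep_mul (i : J) h g :
  (forall x a, h (upd x i a) = h x) -> (forall x, avg i g x = 1) ->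
  Ex (fun x => h x * g x) = Ex h.
Proof.
move=> hi g1; rewrite -(Ex_avg i); apply: eq_Ex => x.
rewrite /avg; under eq_bigr do rewrite hi mulrCA.
by rewrite -mulr_sumr -/(avg i g x) g1 mulr1.
Qed.

Lemma avgB (i : J) h g x : avg i (fun y => h y - g y) x = avg i h x - avg i g x.
Proof. by rewrite /avg -sumrB; apply: eq_bigr => a _; rewrite mulrBr. Qed.

Lemma ler_norm_avg (i : J) h x : `|avg i h x| <= avg i (fun y => `|h y|) x.
Proof.
apply: le_trans (ler_norm_sum _ _ _) _; apply: ler_sum => a _.
by rewrite normrM ger0_norm.
Qed.

Lemma avg_indep (i : J) h x a : avg i h (upd x i a) = avg i h x.
Proof. by apply: eq_bigr => b _; rewrite upd_upd. Qed.

Lemma avg_indep2 (i j : J) h :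
  (forall x a, h (upd x j a) = h x) ->
  forall x a, avg i h (upd x j a) = avg i h x.
Proof.
move=> hj x a; apply: eq_bigr => b _.
have [<-|ji] := eqVneq j i; first by rewrite upd_upd.
by rewrite updC // hj.
Qed.

Definition avgs (s : seq J) h := foldr (fun i g => avg i g) h s.

Lemma avgs_indep s h i : i \in s -> forall x a, avgs s h (upd x i a) = avgs s h x.
Proof.
elim: s => //= j s IH; rewrite inE => /orP[/eqP -> x a|/IH]; first exact: avg_indep.
by move=> hs x a; apply: avg_indep2.
Qed.

Lemma Ex_avgs s h : Ex (avgs s h) = Ex h.
Proof. by elim: s => //= j s IH; rewrite Ex_avg. Qed.

Lemma avgs_enum h x : avgs (enum J) h x = Ex h.
Proof.
have cst y : avgs (enum J) h y = avgs (enum J) h x.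
  (* A function averaged over all coordinates ignores each of them; [mix] turns [y] into [x] one
     coordinate at a time. *)
  pose mix (s : seq J) : J -> A := fun j => if j \in s then x j else y j.
  have Hm s : avgs (enum J) h (mix s) = avgs (enum J) h y.
    elim: s => [|j s IH]; first by congr (avgs _ _ _); apply/funext.
    rewrite -IH -[RHS](avgs_indep h (i := j) _ _ (x j)) ?mem_enum //.
    by congr (avgs _ _ _); apply/funext => k; rewrite /mix /upd inE; case: eqP => [->|].
  rewrite -(Hm (enum J)); congr (avgs _ _ _); apply/funext => j.
  by rewrite /mix mem_enum.
rewrite -[RHS](Ex_avgs (enum J)) -(Ex_cst (avgs (enum J) h x)).
exact: eq_Ex.
Qed.

(* The L1 form of the Efron-Stein inequality. *)
Lemma Ex_norm_centered h :
  Ex (fun x => `|h x - Ex h|) <= \sum_i Ex (fun x => `|h x - avg i h x|).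
Proof.
have step s : Ex (fun x => `|h x - avgs s h x|) <=
    \sum_(i <- s) Ex (fun x => `|h x - avg i h x|).
  elim: s => [|i s IH].
    rewrite big_nil /= (eq_Ex (g := fun=> 0)) ?Ex_cst // => x.
    by rewrite subrr normr0.
  rewrite big_cons; apply: le_trans (lerD (lexx _) IH).
  rewrite -(Ex_avg i (fun x => `|h x - avgs s h x|)) -ExD.
  apply: ler_Ex => x /=.
  (* Telescoping: split off coordinate [i]; the rest is an average of the difference for the shorter
     list, and averaging contracts L1. *)
  rewrite (_ : h x - _ = (h x - avg i h x) + avg i (fun y => h y - avgs s h y) x).
    by apply: le_trans (ler_normD _ _) _; rewrite lerD2l ler_norm_avg.
  by rewrite avgB; ring.
have := step (enum J); rewrite big_enum /=.
by under eq_Ex do rewrite avgs_enum.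
Qed.

End Fin.

Lemma Ex_marg (I J : finType) (tau : I -> J) (h : (I -> A) -> R) :
  injective tau -> Ex (fun x : J -> A => h (x \o tau)) = Ex h.
Proof.
move=> tauI; rewrite /Ex.
rewrite (partition_big (fun x : {ffun J -> A} => [ffun i => x (tau i)]) xpredT) //=.
apply: eq_bigr => z _.
transitivity (\sum_(x : {ffun J -> A} | [ffun i => x (tau i)] == z) (\prod_j p (x j)) * h z).
  by apply: eq_bigr => x /eqP <-; congr (_ * h _); apply/funext => i; rewrite ffunE.
rewrite -mulr_suml; congr (_ * _).
(* The fibre over [z] is a product set, so its weight factors: coordinates in the image of [tau] are
   pinned by [z], all others sum to 1. *)
pose Q (j : J) : pred A := fun a => [forall i, (tau i == j) ==> (a == z i)].
transitivity (\sum_(x in family Q) \prod_j p (x j)).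
  apply: eq_bigl => x; apply/eqP/familyP => [/ffunP E j|H].
    by apply/forallP => i; apply/implyP => /eqP <-; rewrite -E ffunE.
  by apply/ffunP => i; rewrite ffunE; have /forallP/(_ i) := H (tau i); rewrite eqxx => /eqP.
rewrite -(bigA_distr_big_dep Q (fun _ a => p a)).
rewrite (bigID (mem (tau @: I))) /= [X in _ * X]big1 ?mulr1; last first.
  move=> j jn; rewrite (eq_bigl xpredT) // => a; apply/forallP => i.
  by apply/implyP => /eqP E; move: jn; rewrite -E imset_f.
rewrite big_imset /=; last by move=> i j _ _; exact: tauI.
apply: eq_bigr => i _; rewrite (big_pred1 (z i)) // => a.
apply/forallP/eqP => [/(_ i)|-> k]; first by rewrite eqxx => /eqP.
by apply/implyP => /eqP /tauI ->.
Qed.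

Lemma Ex_coord (J : finType) (i : J) (f : A -> R) :
  Ex (fun x : J -> A => f (x i)) = \sum_a p a * f a.
Proof.
rewrite -(Ex_avg i) -[RHS](Ex_cst J); apply: eq_Ex => x.
by apply: eq_bigr => a _; rewrite /upd eqxx.
Qed.

Lemma Ex_prod_coord (J : finType) (k : nat) (u : 'I_k -> J) (f : A -> R) :
  Ex (fun x => \prod_j f (x (u j))) =
  \prod_i \sum_a p a * f a ^+ #|[pred j | u j == i]|.
Proof.
rewrite (bigA_distr_bigA (fun i a => p a * f a ^+ #|[pred j | u j == i]|)).
apply: eq_bigr => x _; rewrite big_split /=; congr (_ * _).
rewrite (partition_big u xpredT) //=; apply: eq_bigr => i _.
rewrite -prodr_const; apply: eq_big => [j|j /eqP -> //]; by rewrite inE.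
Qed.

End ProductExpectation.

(** Both expectations factor over sites, a site hit [l] times giving an [l]-th moment. The
    multiplicity [k.+1] occurs only if all [u j] coincide; otherwise only the lower moments appear,
    and these agree. *)
Lemma Ex_prod_coord_eq (R : realType) (A B : finType) (p : A -> R) (q : B -> R)
    (f : A -> R) (g : B -> R) (J : finType) (k : nat) (u : 'I_k.+1 -> J) :
  \sum_a p a = 1 ->
  (forall l, (l < k.+1)%N -> \sum_a p a * f a ^+ l = \sum_b q b * g b ^+ l) ->
  Ex q (fun y => \prod_j g (y (u j))) - Ex p (fun x => \prod_j f (x (u j))) =
  [forall j, u j == u ord0]%:R *
    (\sum_b q b * g b ^+ k.+1 - \sum_a p a * f a ^+ k.+1).
Proof.
move=> p_sum1 low; rewrite !Ex_prod_coord.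
case: forallP => [cst|ncst].
  have card i : #|[pred j | u j == i]| = ((u ord0 == i) * k.+1)%N.
    have [<-|N] := eqVneq (u ord0) i.
      rewrite mul1n -[RHS]card_ord; apply: eq_card => j; rewrite !inE; exact: cst.
    by apply/eqP; rewrite mul0n -leqn0 leqNgt; apply/negP => /card_gt0P[j];
      rewrite !inE (eqP (cst j)) (negbTE N).
  rewrite (bigD1 (u ord0)) //= [X in _ - X](bigD1 (u ord0)) //= !card eqxx !mul1n mul1r.
  have E0 i : i != u ord0 -> #|[pred j | u j == i]| = 0%N.
    by move=> iu; rewrite card eq_sym (negbTE iu).
  have Ep : \prod_(i | i != u ord0) \sum_a p a * f a ^+ #|[pred j | u j == i]| = 1.
    by apply: big1 => i /E0 ->; under eq_bigr do rewrite mulr1.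
  have Eq : \prod_(i | i != u ord0) \sum_b q b * g b ^+ #|[pred j | u j == i]| = 1.
    by apply: big1 => i /E0 ->; rewrite -low //; under eq_bigr do rewrite mulr1.
  by rewrite Ep Eq !mulr1.
rewrite mul0r; apply/eqP; rewrite subr_eq0; apply/eqP; apply: eq_bigr => i _.
rewrite low // -[X in (_ < X)%N]card_ord; apply: proper_card; apply/properP; split.
  by apply/fintype.subsetP.
have [j ji] : exists j, u j != i.
  apply/existsP; apply: contra_notT ncst; rewrite negb_exists => /forallP H j.
  by have := H j; have := H ord0; rewrite !negbK => /eqP -> /eqP ->.
by exists j; rewrite // inE.
Qed.

(** * An entropy inequality for couplings, and auxiliary estimates *)

Lemma ln_le_subr1 (R : realType) (x : R) : 0 < x -> ln x <= x - 1.
Proof. by move=> x0; have := expR_ge1Dx (ln x); rewrite lnK ?posrE // => ?; lra. Qed.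

(* [Px x * kap x y / Q y] splits as [(w Px kap / V) * (V / (Q w))], where [V] is
   the second marginal of [w J]; then use [ln t <= t - 1] on both factors. *)
Lemma coupling_gibbs (R : realType) (U V : finType) (J : U -> V -> R)
    (w : U -> R) (kap : U -> V -> R) :
  (forall x y, 0 <= J x y) -> \sum_x \sum_y J x y = 1 ->
  (forall x, 0 < w x) -> \sum_x \sum_y J x y * w x = 1 ->
  (forall x y, 0 < kap x y) -> (forall x, \sum_y kap x y = 1) ->
  \sum_x \sum_y J x y * w x *
    (ln (\sum_y' J x y') + ln (kap x y) - ln (\sum_x' J x' y)) <= 0.
Proof.
move=> J0 J1 w0 w1 k0 k1.
pose P x := \sum_y J x y; pose Q y := \sum_x J x y.
pose W y := \sum_x J x y * w x.
have P0 x : 0 <= P x by apply: sumr_ge0.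
have W0 y : 0 <= W y by apply: sumr_ge0 => x _; rewrite mulr_ge0 // ltW.
apply: (@le_trans _ _ (\sum_x \sum_y
   ((w x * P x * kap x y - J x y * w x) + (J x y * (W y / Q y) - J x y * w x)))).
  apply: ler_sum => x _; apply: ler_sum => y _; rewrite -/(P x) -/(Q y).
  have [Jz|Jn] := eqVneq (J x y) 0.
    rewrite Jz !mul0r !subr0 addr0 !mulr_ge0 // ltW //.
  have Jp : 0 < J x y by rewrite lt0r Jn J0.
  have wp := w0 x; have kp := k0 x y.
  have Pp : 0 < P x.
    apply: lt_le_trans Jp _; rewrite /P (bigD1 y) //= lerDl; exact: sumr_ge0.
  have Qp : 0 < Q y.
    apply: lt_le_trans Jp _; rewrite /Q (bigD1 x) //= lerDl; exact: sumr_ge0.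
  have JWle : J x y * w x <= W y.
    rewrite /W (bigD1 x) //= lerDl; apply: sumr_ge0 => z _.
    by rewrite mulr_ge0 // ltW.
  have Wp : 0 < W y by apply: lt_le_trans JWle; rewrite mulr_gt0.
  have Wn := lt0r_neq0 Wp; have Qn := lt0r_neq0 Qp; have wn := lt0r_neq0 wp.
  pose a := w x * P x * kap x y / W y; pose b := W y / (Q y * w x).
  have ap : 0 < a by rewrite /a divr_gt0 // !mulr_gt0.
  have bp : 0 < b by rewrite /b divr_gt0 // mulr_gt0.
  have -> : ln (P x) + ln (kap x y) - ln (Q y) = ln a + ln b.
    rewrite -lnM ?posrE // -ln_div ?posrE ?mulr_gt0 // -lnM ?posrE //; congr ln.
    by rewrite /a /b; field; rewrite Wn Qn wn.
  have la := ln_le_subr1 ap; have lb := ln_le_subr1 bp.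
  apply: (@le_trans _ _ (J x y * w x * ((a - 1) + (b - 1)))).
    by rewrite ler_pM2l ?mulr_gt0 // lerD.
  have -> : J x y * w x * (a - 1 + (b - 1)) =
     (J x y * w x * a - J x y * w x) + (J x y * w x * b - J x y * w x) by ring.
  have wPk : 0 < w x * P x * kap x y by rewrite !mulr_gt0.
  apply: lerD; apply: lerB => //.
    by rewrite /a mulrA ler_pdivrMr // mulrC ler_pM2l.
  by rewrite le_eqVlt /b; apply/orP; left; apply/eqP; field; rewrite Qn wn.
under eq_bigr do rewrite big_split /= !sumrB.
rewrite big_split /= !sumrB !w1.
have -> : \sum_x \sum_y w x * P x * kap x y = 1.
  under eq_bigr do rewrite -mulr_sumr k1 mulr1 /P mulr_sumr.
  by rewrite -w1; apply: eq_bigr => x _; apply: eq_bigr => y _; rewrite mulrC.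
rewrite subrr add0r subr_le0 exchange_big /= -w1 [leRHS]exchange_big /=.
apply: ler_sum => y _; rewrite -mulr_suml -/(Q y) -/(W y).
have [->|Qn] := eqVneq (Q y) 0; first by rewrite mul0r.
by rewrite mulrC divfK.
Qed.

(** Serves to kill a quantity independent of [m], later the gap between two moments. *)
Lemma expR_poly_decay (R : realType) (a : nat) (c C x : R) (N : nat) : 0 < c ->
  (forall m, (N <= m)%N -> x <= C * m.+1%:R ^+ a * expR (- (c * m%:R))) -> x <= 0.
Proof.
move=> c0 H; rewrite leNgt; apply/negP => x0.
have Cp : 0 < C.
  have := lt_le_trans x0 (H N (leqnn _)).
  rewrite -mulrA pmulr_lgt0 // mulr_gt0 ?expR_gt0 // exprn_gt0 //.
(* [expR (c m) >= (c m)^(a+2) / (a+2)!] beats the polynomial factor *)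
pose K := C * 2 ^+ a * (a.+1`!)%:R / c ^+ a.+1.
have fp : 0 < (a.+1`!)%:R :> R by rewrite ltr0n fact_gt0.
have bound m : (N <= m)%N -> (0 < m)%N -> x * m%:R <= K.
  move=> Nm m0; have mp : 0 < m%:R :> R by rewrite ltr0n.
  have cm : 0 < c * m%:R by rewrite mulr_gt0.
  have E : (c * m%:R) ^+ a.+1 / (a.+1`!)%:R <= expR (c * m%:R).
    by have := expR_ge1Dxn a (ltW cm); lra.
  have E2 : expR (- (c * m%:R)) <= (a.+1`!)%:R / (c * m%:R) ^+ a.+1.
    by rewrite expRN -[leRHS]invf_div lef_pV2 // posrE ?expR_gt0 // divr_gt0 // exprn_gt0.
  have S : m.+1%:R ^+ a <= (2 * m%:R) ^+ a :> R.
    by apply: lerXn2r; rewrite ?nnegrE ?mulr_ge0 // -natrM ler_nat; lia.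
  have cn : c != 0 by rewrite gt_eqF.
  have mn : m%:R != 0 :> R by rewrite gt_eqF.
  rewrite -ler_pdivlMr //; apply: le_trans (H m Nm) _.
  apply: le_trans (_ : C * (2 * m%:R) ^+ a * ((a.+1`!)%:R / (c * m%:R) ^+ a.+1) <= _).
    apply: ler_pM; rewrite ?mulr_ge0 ?exprn_ge0 ?expR_ge0 ?(ltW Cp) //.
    by rewrite ler_pM2l.
  rewrite /K !exprMn !exprS le_eqVlt; apply/orP; left; apply/eqP; field.
  by rewrite mn cn !expf_neq0.
have [k Hk] : exists k : nat, K / x < k%:R.
  exists (Num.Def.archi_bound (K / x)); apply: archi_boundP.
  by rewrite /K !(mulr_ge0, invr_ge0, exprn_ge0) // ?ltW //.
have := bound (maxn k (maxn N 1)).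
rewrite leq_max leq_maxl orbT => /(_ isT).
have -> : (0 < maxn k (maxn N 1))%N by lia.
move=> /(_ isT); rewrite leNgt => /negP; apply.
rewrite mulrC -ltr_pdivrMr //; apply: lt_le_trans Hk _.
by rewrite ler_nat leq_maxl.
Qed.

(** Equal moments give equal expectations of every polynomial. One that vanishes at all values of
    [la] and [mu] except [t] isolates the mass at [t]. *)
Lemma moments_card_eq (R : realType) (A B : finType) (p la : A -> R) (q mu : B -> R) :
  (forall k : nat, \sum_a p a * la a ^+ k = \sum_b q b * mu b ^+ k) ->
  forall t : R, \sum_(a | la a == t) p a = \sum_(b | mu b == t) q b.
Proof.
move=> H t.
have Hpoly (P : {poly R}) : \sum_a p a * P.[la a] = \sum_b q b * P.[mu b].
  under eq_bigr do rewrite horner_coef mulr_sumr.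
  under [RHS]eq_bigr do rewrite horner_coef mulr_sumr.
  rewrite exchange_big [RHS]exchange_big /=; apply: eq_bigr => i _.
  under eq_bigr do rewrite mulrCA; under [RHS]eq_bigr do rewrite mulrCA.
  by rewrite -!mulr_sumr H.
pose P : {poly R} := (\prod_(a | la a != t) ('X - (la a)%:P)) *
  \prod_(b | mu b != t) ('X - (mu b)%:P).
have Pt : P.[t] != 0.
  rewrite hornerM !horner_prod mulf_neq0 //; apply/prodf_neq0 => i it;
    by rewrite hornerXsubC subr_eq0 eq_sym.
have PA a : la a != t -> P.[la a] = 0.
  by move=> at_; rewrite hornerM horner_prod (bigD1 a) //= hornerXsubC subrr !mul0r.
have PB b : mu b != t -> P.[mu b] = 0.
  by move=> bt; rewrite hornerM (horner_prod _ _ (fun b => 'X - (mu b)%:P)) (bigD1 b) //=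
    hornerXsubC subrr mul0r mulr0.
have := Hpoly P.
rewrite (bigID (fun a => la a == t)) /= [X in _ + X]big1 ?addr0;
  last by move=> a /PA ->; rewrite mulr0.
rewrite [RHS](bigID (fun b => mu b == t)) /= [X in _ = _ + X]big1 ?addr0;
  last by move=> b /PB ->; rewrite mulr0.
under eq_bigr => a /eqP at_ do rewrite at_.
under [RHS]eq_bigr => b /eqP bt do rewrite bt.
by rewrite -!mulr_suml => /(mulIf Pt).
Qed.

(* [u j - z] avoids a window of half-width [m] around [0] for every [j]. *)
Lemma cyclic_gap (n k m : nat) (u : 'I_k -> 'I_n.+1) : (k * (2 * m) < n.+1)%N ->
  exists z : 'I_n.+1, forall j, (m <= (u j - z)%R < n.+1 - m)%N.
Proof.
move=> kn.
pose bad : pred 'I_n.+1 := fun v => ~~ (m <= v < n.+1 - m)%N.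
have cbad : (#|bad| <= 2 * m)%N.
  (* The bad residues are the first [m] and the last [m]; unless [2 m] exceeds [n], [f] packs them
     injectively into [0, 2m). *)
  pose f (v : 'I_n.+1) : nat := if (v < m)%N then v : nat else (v + 2 * m - n.+1)%N.
  have [big|small] := leqP n.+1 (2 * m).
    by apply: leq_trans (max_card _) _; rewrite card_ord.
  have fb v : bad v -> (f v < 2 * m)%N.
    by rewrite /bad /f; have := ltn_ord v; case: ifP => ?; lia.
  pose g v : 'I_(2 * m).+1 := inord (f v).
  have gI : {in bad &, injective g}.
    move=> v w bv bw /(congr1 val); rewrite /= !inordK ?ltnS ?(ltnW (fb _ _)) // => E.
    apply: val_inj => /=; move: E bv bw; rewrite /f /bad !unfold_in.
    have := ltn_ord v; have := ltn_ord w.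
    by do 2 case: ifP => ?; lia.
  rewrite -(card_in_imset gI).
  apply: leq_trans (subset_leq_card (_ : _ \subset [set~ (ord_max : 'I_(2 * m).+1)]%SET)) _.
    apply/fintype.subsetP => y /imsetP[v bv ->]; rewrite !inE.
    apply/eqP => /(congr1 val); rewrite /= inordK ?ltnS ?(ltnW (fb _ bv)) // => E.
    by have := fb _ bv; rewrite E ltnn.
  by rewrite cardsC1 card_ord.
(* Each [j] excludes at most [2 m] values of [z], so a union bound leaves one. *)
pose Bad := (\bigcup_j [set z | bad (u j - z)%R])%SET.
have cB : (#|Bad| <= k * (2 * m))%N.
  apply: (@leq_trans (\sum_(j < k) #|[set z | bad (u j - z)%R]%SET|)).
    rewrite /Bad; elim/big_rec2: _ => [|j N' S _ IH]; first by rewrite finset.cards0.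
    by apply: leq_trans (leq_card_setU _ _) _; rewrite leq_add2l.
  rewrite -[k in (k * _)%N]card_ord -sum_nat_const; apply: leq_sum => j _.
  apply: leq_trans cbad; rewrite -(card_imset bad (f := fun v => u j - v));
    last by move=> v w /subrI.
  apply: subset_leq_card; apply/fintype.subsetP => z; rewrite inE => bz.
  by apply/imsetP; exists (u j - z) => //; rewrite subKr.
have : (0 < #|~: Bad|)%N.
  by rewrite cardsCs finset.setCK subn_gt0 card_ord; apply: leq_ltn_trans cB kn.
case/card_gt0P => z; rewrite !inE => /finset.bigcupP zB; exists z => j.
by apply: contraT => bj; case: zB; exists j => //; rewrite inE.
Qed.

(** * Reduction to finitely many coordinates *)

(** Sites outside the image of [iota] get the default [a0]; this is harmless for functions that read
    only sites in the image. *)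
Definition ext (d : nat) (A : Type) (a0 : A) (I : finType) (iota : I -> Zd d)
    (x : I -> A) : Zd d -> A :=
  fun u => if [pick i | iota i == u] is Some i then x i else a0.

Lemma extE d (A : Type) (a0 : A) (I : finType) (iota : I -> Zd d) (x : I -> A) i :
  injective iota -> ext a0 iota x (iota i) = x i.
Proof.
move=> iI; rewrite /ext; case: pickP => [j /eqP/iI -> //|/(_ i)].
by rewrite eqxx.
Qed.

Definition inball (d m : nat) : pred (Zd d) :=
  fun u => [forall i, `|u ord0 i| <= m%:Z].

Lemma inballP d m (u : Zd d) : reflect (@Defs.ball0 d m u) (inball m u).
Proof. exact: forallP. Qed.

Section FiniteValued.
Context {disp : measure_display} {X : measurableType disp} {R : realType}.
Variables (P : probability X R) (T : finType) (Z : X -> T).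
Hypothesis mZ : forall t, measurable (Z @^-1` [set t]).

Lemma measurable_finval (Q : set T) : measurable [set x | Q (Z x)].
Proof.
rewrite (_ : [set x | _] = \bigcup_(t in Q) Z @^-1` [set t]).
  by apply: fin_bigcup_measurable => //; exact: finite_finset.
by apply/seteqP; split => [x Qx|x [t Qt /= ->//]]; exists (Z x).
Qed.

Lemma prob_finval (Q : pred T) :
  fine (P [set x | Q (Z x)]) = \sum_(t | Q t) fine (P (Z @^-1` [set t])).
Proof.
rewrite sum_fine; last by move=> t _; exact: fin_num_measure.
congr fine; rewrite (_ : [set x | _] = \bigcup_(t in [set t | Q t]) Z @^-1` [set t]).
  rewrite measure_fin_bigcup //; last 2 first.
  - exact: finite_finset.
  - by move=> s t _ _ [x [/= <- <-]].
  rewrite fsbig_finite; last exact: finite_finset.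
  rewrite -[RHS]big_filter; apply: perm_big; apply: uniq_perm.
  - exact: finmap.fset_uniq.
  - by rewrite filter_uniq // index_enum_uniq.
  - move=> t; rewrite in_fset_set; last exact: finite_finset.
    rewrite mem_filter mem_index_enum andbT; by apply/idP/idP; rewrite inE.
by apply/seteqP; split => [x Qx|x [t Qt /= ->//]]; exists (Z x).
Qed.
End FiniteValued.

(** * I.i.d. measures: finite marginals and shift invariance *)

Section IID.
Context {R : realType} {d : nat} {A : finType} {a0 : A}.
Implicit Types (p : A -> R) (mu : probability (Cfg d a0) R).

Lemma measurable_coord (i : Zd d) (a : A) :
  measurable [set x : Cfg d a0 | x i = a].
Proof. by apply: sub_sigma_algebra; exists i, a. Qed.

Lemma measurable_pattern (I : finType) (iota : I -> Zd d) (xi : {ffun I -> A}) :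
  measurable ((fun x : Cfg d a0 => [ffun i => x (iota i)]) @^-1` [set xi]).
Proof.
rewrite (_ : _ @^-1` _ = \bigcap_(i in [set: I]) [set x : Cfg d a0 | x (iota i) = xi i]).
  apply: fin_bigcap_measurable => [|i _]; first exact: finite_finset.
  exact: measurable_coord.
apply/seteqP; split => [x /= <- i _ /=|x H /=]; first by rewrite ffunE.
by apply/ffunP => i; rewrite ffunE; exact: H.
Qed.

Lemma iid_pattern p mu (I : finType) (iota : I -> Zd d) (xi : {ffun I -> A}) :
  iid_measure p mu -> injective iota ->
  fine (mu ((fun x : Cfg d a0 => [ffun i => x (iota i)]) @^-1` [set xi])) =
  \prod_i p (xi i).
Proof.
move=> iid iI.
have := iid [seq iota i | i <- enum I] (ext a0 iota xi).
rewrite map_inj_uniq // enum_uniq => /(_ isT).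
rewrite big_map big_enum /= => E.
transitivity (fine (\prod_i p (ext a0 iota xi (iota i)))%:E); last first.
  by apply: eq_bigr => i _; rewrite extE.
rewrite -E; congr (fine (mu _)); apply/seteqP; split => x /=.
  move=> <- _ /mapP[i _ ->]; by rewrite extE // ffunE.
move=> H; apply/ffunP => i; rewrite ffunE (H (iota i)) ?extE //.
by apply: map_f; rewrite mem_enum.
Qed.

Lemma prob_local p mu (I : finType) (iota : I -> Zd d) (Q : pred (Zd d -> A)) :
  iid_measure p mu -> injective iota ->
  (forall x x', (forall i, x (iota i) = x' (iota i)) -> Q x = Q x') ->
  fine (mu [set x : Cfg d a0 | Q x]) = Ex p (fun xi => (Q (ext a0 iota xi))%:R).
Proof.
move=> iid iI Qloc.
pose Z (x : Cfg d a0) := [ffun i => x (iota i)].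
rewrite (_ : [set x : Cfg d a0 | Q x] = [set x : Cfg d a0 | Q (ext a0 iota (Z x))]).
  rewrite (prob_finval mu (measurable_pattern iota) (fun xi => Q (ext a0 iota xi))).
  rewrite /Ex big_mkcond /=; apply: eq_bigr => xi _.
  by case: ifP => _; rewrite ?mulr0 // mulr1 (iid_pattern _ iid).
apply/seteqP; split => x /=.
  by rewrite (Qloc x (ext a0 iota (Z x))) // => i; rewrite extE // ffunE.
by rewrite (Qloc x (ext a0 iota (Z x))) // => i; rewrite extE // ffunE.
Qed.

Lemma measurable_shift (v : Zd d) :
  measurable_fun setT (Defs.shift v : Cfg d a0 -> Cfg d a0).
Proof.
apply: (@measurability _ _ (Cfg d a0) (Cfg d a0) setT _ (@cyl d A a0)) => // _ [_ [i [a ->]] <-].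
rewrite setTI; exact: measurable_coord.
Qed.

Lemma measurable_local (I : finType) (iota : I -> Zd d) (C : set (Cfg d a0)) :
  injective iota ->
  (forall x x' : Cfg d a0, (forall i, x (iota i) = x' (iota i)) -> C x -> C x') ->
  measurable C.
Proof.
move=> iI Cloc; pose Z (x : Cfg d a0) := [ffun i => x (iota i)].
rewrite (_ : C = [set x : Cfg d a0 | C (ext a0 iota (Z x))]).
  exact: (measurable_finval (measurable_pattern iota) (fun xi => C (ext a0 iota xi))).
by apply/seteqP; split => x /=; apply: Cloc => i; rewrite extE // ffunE.
Qed.

(** Uniqueness of measures on the pi-system [G] of events that depend on finitely many coordinates:
    there both sides are the same finite product expectation. *)
Lemma iid_shift p mu (v : Zd d) (E : set (Cfg d a0)) :
  iid_measure p mu -> measurable E -> mu (Defs.shift v @^-1` E) = mu E.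
Proof.
move=> iid mE.
pose f : {mfun Cfg d a0 >-> Cfg d a0} :=
  HB.pack (Defs.shift v : Cfg d a0 -> Cfg d a0)
    (isMeasurableFun.Build _ _ _ _ _ (measurable_shift v)).
pose G : set (set (Cfg d a0)) := [set C | exists s : seq (Zd d),
    forall x x' : Cfg d a0, (forall i, i \in s -> x i = x' i) -> C x -> C x'].
have mG C : G C -> measurable C.
  move=> [s Cs]; apply: (@measurable_local (seq_sub s) val) => [|x x' xx'].
    exact: val_inj.
  by apply: Cs => i si; exact: (xx' (SeqSub si)).
apply: (@measure_unique _ R (Cfg d a0) G (fun=> setT) _ _ _ _ (distribution mu f) mu) => //.
- apply/seteqP; split; last by apply: smallest_sub => //; exact: sigma_algebra_measurable.
  apply: smallest_sub => [|C [i [a ->]]]; first exact: smallest_sigma_algebra.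
  apply: sub_sigma_algebra; exists [:: i] => x x' /= H <-.
  by rewrite H // inE.
- move=> C D [s Cs] [t Dt]; exists (s ++ t) => x x' H [Cx Dx]; split.
    by apply: Cs Cx => i si; apply: H; rewrite mem_cat si.
  by apply: Dt Dx => i si; apply: H; rewrite mem_cat si orbT.
- by move=> _; exists [::].
- by rewrite bigcup_const.
- move=> C GC; have [s Cs] := GC.
  pose iota (i : seq_sub s) : Zd d := val i.
  pose Q (x : Zd d -> A) : bool := `[< C x >].
  have Ql x x' : (forall i, x (iota i) = x' (iota i)) -> Q x = Q x'.
    move=> xx'; apply/asboolP/asboolP; apply: Cs => i si;
      by have := xx' (SeqSub si).
  rewrite (_ : C = [set x : Cfg d a0 | Q x]); last first.
    by apply/seteqP; split => x /asboolP.
  have iI : injective iota by exact: val_inj.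
  have vI : injective (fun i => iota i + v) by move=> i j /addIr /iI.
  have mQ : measurable [set x : Cfg d a0 | Q x].
    by apply: (measurable_local iI) => x x' /Ql /= ->.
  have E1 : fine (mu [set x : Cfg d a0 | Q x]) =
            fine (mu (Defs.shift v @^-1` [set x : Cfg d a0 | Q x])).
    rewrite (prob_local iid iI Ql).
    rewrite (prob_local (Q := fun x => Q (Defs.shift v x)) iid vI); last first.
      by move=> x x' xx'; apply: Ql => i; exact: xx'.
    apply: eq_bigr => xi _; congr (_ * (nat_of_bool _)%:R); apply: Ql => i.
    by rewrite extE // /Defs.shift (extE _ (iota := fun i => iota i + v)).
  rewrite -[RHS]fineK ?fin_num_measure // E1 fineK //.
  apply: fin_num_measure; rewrite -[X in measurable X]setTI.
  exact: measurable_shift.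
- by move=> _; rewrite ltey_eq fin_num_measure.
Qed.

End IID.

(** The box of side [n] with lowest corner (b, ..., b). With [b = - m] and side [2 m + 1] it
    enumerates the ball of radius [m]. *)
Definition emb (d n : nat) (b : int) (z : 'rV['I_n]_d) : Zd d :=
  \row_i ((z ord0 i : nat)%:Z + b).

Lemma emb_inj d n b : injective (@emb d n b).
Proof.
move=> z z' /rowP H; apply/rowP => i; have := H i; rewrite !mxE.
by move=> /addIr [] /val_inj.
Qed.

Definition unemb (d n : nat) (b : int) (u : Zd d) : 'rV['I_n.+1]_d :=
  \row_i inord `|u ord0 i - b|%N.

Lemma unembK d n b (u : Zd d) : (forall i, b <= u ord0 i <= b + n%:Z) ->
  emb b (unemb n b u) = u.
Proof.
move=> H; apply/rowP => i; rewrite !mxE inordK; last by have := H i; lia.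
by case/andP: (H i) => bu _; rewrite gez0_abs ?subrK // subr_ge0.
Qed.

Lemma emb_inball d m (z : 'rV['I_(2 * m).+1]_d) : inball m (emb (- m%:Z) z).
Proof. by apply/forallP => i; rewrite mxE; have := ltn_ord (z ord0 i); lia. Qed.

Lemma inball_emb d m (u : Zd d) : inball m u ->
  exists z : 'rV['I_(2 * m).+1]_d, emb (- m%:Z) z = u.
Proof.
move=> /forallP H; exists (unemb (2 * m) (- m%:Z) u); apply: unembK => i.
by have := H i; lia.
Qed.

Lemma inball_add d K L (s t : Zd d) :
  inball K s -> inball L t -> inball (K + L) (s + t).
Proof.
move=> /forallP sK /forallP tL; apply/forallP => i; have := tL i; have := sK i.
by rewrite mxE !ler_norml; move: (s _ _) (t _ _) => a b; lia.
Qed.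

(** * Block codes approximating the factor map *)

Section BlockCode.
Context {R : realType} {d : nat} {A B : finType} {a0 : A} {b0 : B}.
Variables (mu : probability (Cfg d a0) R) (phi : Cfg d a0 -> Cfg d b0).

(* Almost surely, the symbol [phi(.)_0] equals [b] given the pattern of [x] on
   the ball of radius [m]. *)
Definition determines (m : nat) (x : Zd d -> A) (b : B) : Prop :=
  mu.-negligible [set a : Cfg d a0 |
    (forall i, @Defs.ball0 d m i -> a i = x i) /\ phi a 0 <> b].

Definition bad (m : nat) (x : Zd d -> A) : bool :=
  ~~ `[< exists b, determines m x b >].

(** The block code [phi_m]. On a bad window it takes the default [b0]; on a window of probability
    zero every symbol is determined and the choice is immaterial. *)
Definition blk (m : nat) (x : Zd d -> A) : B := xget b0 [set b | determines m x b].

Lemma determines_local m x x' : (forall i, inball m i -> x i = x' i) ->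
  determines m x = determines m x'.
Proof.
move=> xx'; apply/funext => b; rewrite /determines.
have E (a : Cfg d a0) : (forall i, @Defs.ball0 d m i -> a i = x i) =
    (forall i, @Defs.ball0 d m i -> a i = x' i).
  by apply/propext; split => H i im; rewrite H // xx' //; apply/inballP.
congr negligible; apply/seteqP; split => a /= [H1 H2]; split => //.
  by rewrite -E.
by rewrite E.
Qed.

Lemma bad_local m x x' : (forall i, inball m i -> x i = x' i) -> bad m x = bad m x'.
Proof. by move=> xx'; rewrite /bad (determines_local xx'). Qed.

Lemma blk_local m x x' : (forall i, inball m i -> x i = x' i) -> blk m x = blk m x'.
Proof. by move=> xx'; rewrite /blk (determines_local xx'). Qed.

Lemma blk_determines m x : ~~ bad m x -> determines m x (blk m x).
Proof. by rewrite negbK => /asboolP; exact: xgetPex. Qed.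

End BlockCode.

(** * The joint law of the source and its image *)

Section Coupling.
Context {R : realType} {d : nat} {A B : finType} {a0 : A} {b0 : B}.
Variables (p : A -> R) (q : B -> R).
Variables (mu : probability (Cfg d a0) R) (nu : probability (Cfg d b0) R).
Variables (phi : Cfg d a0 -> Cfg d b0).
Hypothesis iidX : iid_measure p mu.
Hypothesis iidY : iid_measure q nu.
Hypothesis fac : factor_map mu nu phi.

Lemma measurable_image_coord (u : Zd d) (b : B) :
  measurable [set x : Cfg d a0 | phi x u = b].
Proof.
case: fac => mphi _ _; rewrite -[X in measurable X]setTI.
exact: (mphi measurableT [set y : Cfg d b0 | y u = b] (measurable_coord u b)).
Qed.

(** A radius above [m] means that the window does not determine the actual symbol [phi x 0]; a bad
    window determines no symbol at all. *)
Lemma bad_coding_radius m :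
  fine (mu [set x : Cfg d a0 | bad mu phi m x]) <=
  fine (mu [set x | (m%:R%:E < coding_radius mu phi x)%E]).
Proof.
pose X (w : Cfg d a0) : {ffun 'rV['I_(2 * m).+1]_d -> A} :=
  [ffun i => w (emb (- m%:Z) i)].
have extX w i : inball m i -> ext a0 (emb (- m%:Z)) (X w) i = w i.
  by move=> /inball_emb[z <-]; rewrite extE ?ffunE //; exact: emb_inj.
pose XY (w : Cfg d a0) := (X w, phi w 0).
have mX x : measurable (X @^-1` [set x]) by exact: measurable_pattern.
have mXY z : measurable (XY @^-1` [set z]).
  case: z => x b; rewrite (_ : _ @^-1` _ = X @^-1` [set x] `&` [set w | phi w 0 = b]).
    by apply: measurableI => //; exact: measurable_image_coord.
  by apply/seteqP; split => w /=; [case=> <- <-|case=> <- <-].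
have mbad : measurable [set x : Cfg d a0 | bad mu phi m x].
  rewrite (_ : [set x | _] = [set x : Cfg d a0 |
      (fun xi => bad mu phi m (ext a0 (emb (- m%:Z)) xi)) (X x)]).
    exact: (measurable_finval mX (fun xi => bad mu phi m (ext a0 (emb (- m%:Z)) xi))).
  by apply/seteqP; split => x /=; rewrite (bad_local mu phi (extX x)).
have rad : [set x | (m%:R%:E < coding_radius mu phi x)%E] =
    [set x : Cfg d a0 | ~ determines mu phi m x (phi x 0)].
  have cE n x : codes_within mu phi n x <-> determines mu phi n x (phi x 0).
    split => H0; refine (negligibleS _ H0) => a /=.
      by move=> [H1 H2] H3; apply: H2; exact: H3.
    by move=> H; apply: contrapT => H2; apply: H => H3; apply: contrapT => H4; apply: H2.
  apply/seteqP; split => x /=.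
    move=> mR dx; move: mR; rewrite ltNge => /negP; apply.
    by apply: ereal_inf_lbound; exists m => //; apply/cE.
  (* Coding within some [n <= m] would imply coding within [m]. Hence all admissible radii are at
     least [m + 1], and so is their infimum, even when there are none. *)
  move=> nd; have H n : codes_within mu phi n x -> (m < n)%N.
    move=> /cE cn; rewrite ltnNge; apply/negP => nm; apply: nd.
    apply: negligibleS cn => a /= [H1 H2]; split => // i im; apply: H1 => k.
    by apply: le_trans (im k) _; rewrite lez_nat.
  apply: (@lt_le_trans _ _ (m.+1%:R%:E)); first by rewrite lte_fin ltr_nat.
  by apply: le_ereal_inf_tmp => _ /= [n /H mn <-]; rewrite lee_fin ler_nat.
have mrad : measurable [set x | (m%:R%:E < coding_radius mu phi x)%E].
  pose Q (z : {ffun 'rV['I_(2 * m).+1]_d -> A} * B) :=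
    ~ determines mu phi m (ext a0 (emb (- m%:Z)) z.1) z.2.
  rewrite rad (_ : [set x | _] = [set x : Cfg d a0 | Q (XY x)]).
    exact: (measurable_finval mXY).
  by apply/seteqP; split => x; rewrite /= /Q (determines_local mu phi (extX x)).
apply: fine_le; rewrite ?fin_num_measure //.
apply: le_measure; rewrite ?inE // rad => x /= bx dx.
by move/negP: bx; apply; apply/asboolP; exists (phi x 0).
Qed.

(** [J] is the joint law of [X] read along [iota] and [phi(X)] read along [iota']. A pair violating
    the last clause has mass zero, by almost sure equivariance. The finite model below sees [phi]
    only through this coupling, the locality of [blk] and [bad], and the probability of bad
    windows. *)
Lemma coupling_exists (m : nat) (I I' : finType) (iota : I -> Zd d) (iota' : I' -> Zd d) :
  injective iota -> injective iota' ->
  exists J : {ffun I -> A} -> {ffun I' -> B} -> R,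
  [/\ forall x y, 0 <= J x y,
      forall x, \sum_y J x y = \prod_i p (x i),
      forall y, \sum_x J x y = \prod_i q (y i)
    & forall x y u, J x y != 0 ->
        (forall v, inball m v -> exists i, iota i = v + iota' u) ->
        ~~ bad mu phi m (Defs.shift (iota' u) (ext a0 iota x)) ->
        y u = blk mu phi m (Defs.shift (iota' u) (ext a0 iota x))].
Proof.
move=> iI iI'; case: fac => mphi equi push.
pose X (w : Cfg d a0) : {ffun I -> A} := [ffun i => w (iota i)].
pose Y (w : Cfg d a0) : {ffun I' -> B} := [ffun i => phi w (iota' i)].
pose XY w := (X w, Y w).
have mX x : measurable (X @^-1` [set x]) by exact: measurable_pattern.
have Ypre y : Y @^-1` [set y] = phi @^-1`
    ((fun w : Cfg d b0 => [ffun i => w (iota' i)]) @^-1` [set y]) by [].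
have mY y : measurable (Y @^-1` [set y]).
  rewrite Ypre -[X in measurable X]setTI.
  exact: (mphi measurableT _ (measurable_pattern iota' y)).
have XYpre x y : XY @^-1` [set (x, y)] = X @^-1` [set x] `&` Y @^-1` [set y].
  by apply/seteqP; split => w /=; [case=> <- <-|case=> <- <-].
have mXY z : measurable (XY @^-1` [set z]).
  by case: z => x y; rewrite XYpre; exact: measurableI.
pose J x y := fine (mu (XY @^-1` [set (x, y)])).
exists J; split.
- by move=> x y; apply: fine_ge0; exact: measure_ge0.
- move=> x; rewrite -(iid_pattern _ iidX iI).
  have := prob_finval mu mXY (fun z => z.1 == x).
  rewrite (_ : [set w | _] = X @^-1` [set x]); last first.
    by apply/seteqP; split => w /= /eqP.
  move=> ->; transitivity (\sum_(x' | x' == x) \sum_y J x' y); first by rewrite big_pred1_eq.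
  by rewrite pair_big_dep; apply: eq_big => -[? ?] //=; rewrite andbT.
- move=> y.
  have := prob_finval mu mXY (fun z => z.2 == y).
  rewrite (_ : [set w | _] = Y @^-1` [set y]); last first.
    by apply/seteqP; split => w /= /eqP.
  rewrite Ypre push; last exact: measurable_pattern.
  rewrite (iid_pattern _ iidY iI') => ->.
  transitivity (\sum_x \sum_(y' | y' == y) J x y').
    by apply: eq_bigr => x _; rewrite big_pred1_eq.
  by rewrite pair_big_dep; apply: eq_big => -[? ?].
move=> x y u Jn cov nb; apply/eqP; apply: contraNT Jn => yu.
pose v := iota' u; pose x0 := Defs.shift v (ext a0 iota x).
have det : determines mu phi m x0 (blk mu phi m x0) by exact: blk_determines.
(* The null set at the origin is carried to the site [v] by shift invariance of [mu]. *)
have N1 : mu.-negligible (Defs.shift v @^-1` [set a : Cfg d a0 |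
    (forall i, @Defs.ball0 d m i -> a i = x0 i) /\ phi a 0 <> blk mu phi m x0]).
  case: det => N [mN N0 sN]; exists (Defs.shift v @^-1` N); split.
  - rewrite -[X in measurable X]setTI; exact: measurable_shift.
  - by rewrite (iid_shift _ iidX).
  - by move=> a /= ?; exact: sN.
rewrite /J (measure_negligible (mXY _)) //.
(* The event of mass [J x y] lies in [N1] together with the null set where equivariance under [v]
   fails. *)
apply: negligibleS (negligibleU N1 (equi v)) => w.
rewrite XYpre => -[/= Xw Yw].
have [E|NE] := pselect (phi (Defs.shift v w) = Defs.shift v (phi w)); last by right.
left; split => [i im|].
  have /cov[k kE] : inball m i by apply/inballP.
  by rewrite /x0 /Defs.shift -kE extE // -Xw ffunE.
rewrite E /Defs.shift add0r => H; move/eqP: yu; apply.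
by rewrite -Yw ffunE H.
Qed.

End Coupling.

(** * The tilting argument *)

Lemma ln_prod (R : realType) (I : finType) (F : I -> R) : (forall i, 0 < F i) ->
  ln (\prod_i F i) = \sum_i ln (F i).
Proof.
move=> F0; suff [] : 0 < \prod_i F i /\ ln (\prod_i F i) = \sum_i ln (F i) by [].
elim/big_rec2: _ => [|i s t _ [t0 E]]; first by rewrite ln1 ltr01.
by rewrite mulr_gt0 // lnM ?posrE // E.
Qed.

Lemma ln_1Bx_ge (R : realType) (x : R) : 0 < x -> x <= 2^-1 -> - (2 * x) <= ln (1 - x).
Proof.
move=> x0 x2; have y0 : 0 < 1 - x by lra.
have := ln_le_subr1 (_ : 0 < (1 - x)^-1); rewrite invr_gt0 => /(_ y0).
rewrite lnV ?posrE // => H.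
have : (1 - x)^-1 <= 1 + 2 * x.
  by rewrite -[leLHS]mul1r ler_pdivrMr //; nra.
by lra.
Qed.

(** * The finite model and a weighted entropy inequality *)

Section FiniteModel.
Context {R : realType} {d : nat} {A B : finType} {a0 : A} {b0 : B}.
Variables (p : A -> R) (q : B -> R).
Hypotheses (p_ge0 : forall a, 0 <= p a) (p_sum1 : \sum_a p a = 1).
Hypotheses (q_ge0 : forall b, 0 <= q b) (q_sum1 : \sum_b q b = 1).
Variables (m : nat) (blk : (Zd d -> A) -> B) (bad : (Zd d -> A) -> bool).
Hypothesis blk_loc : forall x x' : Zd d -> A,
  (forall i, inball m i -> x i = x' i) -> blk x = blk x'.
Hypothesis bad_loc : forall x x' : Zd d -> A,
  (forall i, inball m i -> x i = x' i) -> bad x = bad x'.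
Hypothesis coupling : forall (I I' : finType) (iota : I -> Zd d) (iota' : I' -> Zd d),
  injective iota -> injective iota' ->
  exists J : {ffun I -> A} -> {ffun I' -> B} -> R,
  [/\ forall x y, 0 <= J x y,
      forall x, \sum_y J x y = \prod_i p (x i),
      forall y, \sum_x J x y = \prod_i q (y i)
    & forall x y u, J x y != 0 ->
        (forall v, inball m v -> exists i, iota i = v + iota' u) ->
        ~~ bad (Defs.shift (iota' u) (ext a0 iota x)) ->
        y u = blk (Defs.shift (iota' u) (ext a0 iota x))].
Variable M : R.
Hypotheses (lnp_le : forall a, `|ln (p a)| <= M) (lnq_le : forall b, `|ln (q b)| <= M).

(** Data processing for the law of density [W]: [coupling_gibbs] is applied with a kernel that
    guesses each image symbol by the block code. A good window costs at most [2 * del]; a bad one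
    costs in addition [2 * M] for replacing the true symbol by the block code and [ln (#|B| / del)]
    for the wrong guess. *)
Lemma entropy_bound (I I' : finType) (iota : I -> Zd d) (iota' : I' -> Zd d)
    (W : (I -> A) -> R) (del : R) :
  injective iota -> injective iota' ->
  (forall u v, inball m v -> exists i, iota i = v + iota' u) ->
  (forall x, 0 < W x) -> Ex p W = 1 -> 0 < del -> del <= 2^-1 ->
  Ex p (fun x => W x * (\sum_z ln (p (x z)) -
    \sum_u ln (q (blk (Defs.shift (iota' u) (ext a0 iota x)))))) <=
  #|I'|%:R * (2 * del) + (2 * M + ln (#|B|%:R / del)) *
    \sum_u Ex p (fun x => W x * (bad (Defs.shift (iota' u) (ext a0 iota x)))%:R).
Proof.
move=> iI iI' cov W0 W1 del0 del2; pose at_ u (x : I -> A) := Defs.shift (iota' u) (ext a0 iota x).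
have [J [J0 JX JY Jdet]] := coupling iI iI'.
have cB : 0 < #|B|%:R :> R by rewrite ltr0n; apply/card_gt0P; exists b0.
have cB1 : 1 <= #|B|%:R :> R by rewrite ler1n; apply/card_gt0P; exists b0.
pose L := ln (#|B|%:R / del).
have L0 : 0 <= L.
  by rewrite /L ln_ge0 // ler_pdivlMr // mul1r; lra.
(* Mixing in the uniform law with weight [del] keeps the kernel positive, so a wrong guess has
   finite cost. *)
pose ku (u : I') (x : {ffun I -> A}) (b : B) : R :=
  (1 - del) * (b == blk (at_ u x))%:R + del / #|B|%:R.
have ku0 u x b : 0 < ku u x b.
  by apply: ltr_wpDl; [rewrite mulr_ge0 ?ler0n //; lra|rewrite divr_gt0].
pose kap x (y : {ffun I' -> B}) := \prod_u ku u x (y u).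
have k1 x : \sum_y kap x y = 1.
  rewrite /kap -(bigA_distr_bigA (fun u b => ku u x b)) big1 // => u _.
  rewrite /ku big_split /= -mulr_sumr (bigD1 (blk (at_ u x))) //= eqxx big1; last first.
    by move=> b /negbTE ->.
  by rewrite sumr_const -[_ / _ *+ _]mulr_natr divfK ?gt_eqF //=; ring.
have k0 x y : 0 < kap x y by apply: prodr_gt0.
have J1 : \sum_x \sum_y J x y = 1.
  under eq_bigr do rewrite JX.
  rewrite -[RHS](Ex_cst p_sum1 I 1); apply: eq_bigr => x _; by rewrite mulr1.
have JW : \sum_x \sum_y J x y * W x = 1.
  by rewrite -W1; apply: eq_bigr => x _; rewrite -mulr_suml JX.
pose loss (x : I -> A) : R := \sum_u (2 * del + (2 * M + L) * (bad (at_ u x))%:R).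
pose gain (x : I -> A) : R := \sum_z ln (p (x z)) - \sum_u ln (q (blk (at_ u x))).
have key x y : J x y != 0 ->
    gain x - loss x <= ln (\sum_y' J x y') + ln (kap x y) - ln (\sum_x' J x' y).
  move=> Jn.
  have Jp : 0 < J x y by rewrite lt0r Jn J0.
  (* On the support of [J] all symbols have positive probability, so the logarithms of the product
     weights split into sums. *)
  have pp i : 0 < p (x i).
    rewrite lt0r p_ge0 andbT; apply: contraTneq Jp => pz.
    rewrite -leNgt; apply: (@le_trans _ _ (\sum_y' J x y')).
      by rewrite (bigD1 y) //= lerDl; exact: sumr_ge0.
    by rewrite JX (bigD1 i) //= pz mul0r.
  have qp u : 0 < q (y u).
    rewrite lt0r q_ge0 andbT; apply: contraTneq Jp => pz.
    rewrite -leNgt; apply: (@le_trans _ _ (\sum_x' J x' y)).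
      by rewrite (bigD1 x) //= lerDl; exact: sumr_ge0.
    by rewrite JY (bigD1 u) //= pz mul0r.
  rewrite JX JY /kap !ln_prod // /gain /loss -!addrA lerD2l -!sumrN -!big_split /=.
  apply: ler_sum => u _.
  have [ub|ub] := boolP (bad (at_ u x)).
    have : - L <= ln (ku u x (y u)).
      rewrite /L -lnV ?posrE ?divr_gt0 // ler_ln ?posrE ?invr_gt0 ?divr_gt0 //.
      rewrite invf_div /ku lerDr mulr_ge0 ?ler0n //; lra.
    have := lnq_le (y u); have := lnq_le (blk (at_ u x)).
    by rewrite !ler_norml mulr1 => /andP[? ?] /andP[? ?] ?; lra.
  have yu := Jdet x y u Jn (cov u) ub; rewrite -/(at_ u x) in yu.
  have : - (2 * del) <= ln (ku u x (y u)).
    apply: le_trans (ln_1Bx_ge del0 del2) _; rewrite ler_ln ?posrE //; last lra.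
    by rewrite /ku yu eqxx mulr1 lerDl divr_ge0 // ltW.
  by rewrite yu mulr0 => ?; lra.
have := coupling_gibbs J0 J1 (w := fun x : {ffun I -> A} => W x) (fun x => W0 x) JW k0 k1.
move=> G; have {}G : Ex p (fun x => W x * (gain x - loss x)) <= 0.
  apply: le_trans G; apply: ler_sum => x _.
  rewrite -JX mulr_suml; apply: ler_sum => y _.
  rewrite mulrA.
  have [->|/key H] := eqVneq (J x y) 0; first by rewrite !mul0r.
  by rewrite ler_wpM2l // mulr_ge0 // ltW.
have E : Ex p (fun x => W x * loss x) = #|I'|%:R * (2 * del) +
    (2 * M + L) * \sum_u Ex p (fun x => W x * (bad (at_ u x))%:R).
  transitivity (\sum_u (2 * del + (2 * M + L) * Ex p (fun x => W x * (bad (at_ u x))%:R))).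
    transitivity (Ex p (fun x => \sum_u W x * (2 * del + (2 * M + L) * (bad (at_ u x))%:R))).
      by apply: eq_Ex => x; rewrite mulr_sumr.
    rewrite Ex_sum; apply: eq_bigr => u _.
    have E1 : 2 * del = Ex p (fun x => 2 * del * W x) by rewrite ExZ W1 mulr1.
    rewrite [in RHS]E1 -ExZ -ExD; apply: eq_Ex => x; ring.
  by rewrite big_split /= sumr_const -mulr_sumr -[X in X + _]mulr_natl.
apply: (@le_trans _ _ (Ex p (fun x => W x * loss x))); last by rewrite E.
rewrite -subr_le0 -ExB; apply: le_trans G; apply: ler_Ex => // x.
by rewrite -mulrBr.
Qed.

(** * Expectations of local functions *)

Definition local_on T (K : nat) (H : (Zd d -> A) -> T) : Prop :=
  forall x x', (forall i, inball K i -> x i = x' i) -> H x = H x'.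

(** For [H] local on the ball of radius [K], this is its expectation under the i.i.d. law on Z^d;
    sites outside the ball are frozen at [a0]. *)
Definition EZ (K : nat) (H : (Zd d -> A) -> R) : R :=
  Ex p (fun x : 'rV['I_(2 * K).+1]_d -> A => H (ext a0 (emb (- K%:Z)) x)).

(** On the ball, [g x] reads distinct coordinates of [x], hence is i.i.d. there. Applied to shifted
    windows inside a box and to windows wrapped on the torus. *)
Lemma transfer (J : finType) (K : nat) (g : (J -> A) -> Zd d -> A)
    (tau : Zd d -> J) (H : (Zd d -> A) -> R) :
  local_on K H -> {in inball K &, injective tau} ->
  (forall x i, inball K i -> g x i = x (tau i)) ->
  Ex p (fun x => H (g x)) = EZ K H.
Proof.
move=> HK tI gt.
pose t (z : 'rV['I_(2 * K).+1]_d) := tau (emb (- K%:Z) z).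
have tI' : injective t.
  move=> z z' /tI E; apply: emb_inj (E _ _); exact: emb_inball.
rewrite /EZ -(Ex_marg p_sum1 (fun x => H (ext a0 (emb (- K%:Z)) x)) tI').
apply: eq_Ex => x; apply: HK => i iK; rewrite gt //.
have [z <-] := inball_emb iK; rewrite extE //; exact: emb_inj.
Qed.

Lemma transfer_box (n K : nat) (b : int) (v : Zd d) (H : (Zd d -> A) -> R) :
  local_on K H ->
  (forall s, inball K s -> forall i, b <= (s + v) ord0 i <= b + n%:Z) ->
  Ex p (fun x : 'rV['I_n.+1]_d -> A => H (Defs.shift v (ext a0 (emb b) x))) = EZ K H.
Proof.
move=> HK Hv; apply: (transfer (tau := fun s => unemb n b (s + v))) => //.
  move=> s t /Hv sK /Hv tK /(congr1 (emb b)); rewrite !unembK //; exact: addIr.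
move=> x i /Hv iK; rewrite /Defs.shift -{1}(unembK iK) extE //; exact: emb_inj.
Qed.

Lemma ext_upd (I : finType) (iota : I -> Zd d) (x : I -> A) i a : injective iota ->
  ext a0 iota (upd x i a) = upd (ext a0 iota x) (iota i) a.
Proof.
move=> iI; apply/funext => u; rewrite /ext /upd.
case: pickP => [j /eqP <-|N]; first by rewrite (inj_eq iI).
by case: eqP => // E; have := N i; rewrite E eqxx.
Qed.

Lemma shift_upd (x : Zd d -> A) v a :
  Defs.shift v (upd x v a) = upd (Defs.shift v x) 0 a.
Proof.
apply/funext => u; rewrite /Defs.shift /upd.
by rewrite -[X in u + v == X]add0r (inj_eq (addIr v)).
Qed.

Lemma EZ_avg0 K H : EZ K (avg p 0 H) = EZ K H.
Proof.
have z0 : emb (- K%:Z) (unemb (2 * K) (- K%:Z) 0) = 0 :> Zd d.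
  by apply: unembK => i; rewrite mxE; lia.
rewrite /EZ -[RHS](Ex_avg p_sum1 (unemb (2 * K) (- K%:Z) 0)).
apply: eq_Ex => x; apply: eq_bigr => a _; rewrite ext_upd ?z0 //; exact: emb_inj.
Qed.

Lemma local_avg K i H : local_on K H -> local_on K (avg p i H).
Proof.
move=> HK x x' xx'; apply: eq_bigr => a _; congr (_ * _); apply: HK => j jK.
by rewrite /upd; case: eqP => // _; exact: xx'.
Qed.

Lemma local_shift T K s (H : (Zd d -> A) -> T) : inball K s -> local_on K H ->
  local_on (2 * K) (fun x => H (Defs.shift s x)).
Proof.
move=> sK HK x x' xx'; apply: HK => i iK; apply: xx'.
by rewrite mul2n -addnn; exact: inball_add.
Qed.

Lemma EZ_shift K s (H : (Zd d -> A) -> R) : inball K s -> local_on K H ->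
  EZ (2 * K) (fun x => H (Defs.shift s x)) = EZ K H.
Proof.
move=> sK HK; apply: transfer_box => // t tK i.
have /forallP/(_ i) := inball_add tK sK.
by rewrite ler_norml; move: (_ ord0 i) => a; lia.
Qed.

(** Under the coupling the two products coincide unless one of the [k] windows is bad, and then they
    differ by at most [2 * M ^+ k]. *)
Lemma moment_bound (I I' : finType) (iota : I -> Zd d) (iota' : I' -> Zd d)
    (k : nat) (u : 'I_k -> I') (f : B -> R) :
  injective iota -> injective iota' ->
  (forall u v, inball m v -> exists i, iota i = v + iota' u) ->
  (forall b, `|f b| <= M) ->
  `|Ex p (fun x => \prod_j f (blk (Defs.shift (iota' (u j)) (ext a0 iota x)))) -
    Ex q (fun y => \prod_j f (y (u j)))| <=
  2 * M ^+ k * \sum_j Ex p (fun x => (bad (Defs.shift (iota' (u j)) (ext a0 iota x)))%:R).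
Proof.
move=> iI iI' cov fM.
have [J [J0 JX JY Jdet]] := coupling iI iI'.
pose at_ j (x : I -> A) := Defs.shift (iota' (u j)) (ext a0 iota x).
have EX h : Ex p h = \sum_x \sum_y J x y * h x.
  by apply: eq_bigr => x _; rewrite -JX mulr_suml.
have EY h : Ex q h = \sum_x \sum_y J x y * h y.
  by rewrite exchange_big; apply: eq_bigr => y _ /=; rewrite -JY mulr_suml.
rewrite EX EY -sumrB -Ex_sum -ExZ EX.
apply: le_trans (ler_norm_sum _ _ _) _; apply: ler_sum => x _.
rewrite -sumrB; apply: le_trans (ler_norm_sum _ _ _) _; apply: ler_sum => y _.
rewrite -mulrBr normrM ger0_norm //.
have [->|Jn] := eqVneq (J x y) 0; first by rewrite !mul0r.
apply: ler_wpM2l => //.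
have pM (g : 'I_k -> B) : `|\prod_j f (g j)| <= M ^+ k.
  rewrite normr_prod -[k in M ^+ k]card_ord -prodr_const.
  by apply: ler_prod => j _; rewrite normr_ge0 fM.
have M0 : 0 <= M ^+ k by apply: le_trans (pM (fun=> b0)); rewrite normr_ge0.
have [/existsP[j jb]|nb] := boolP [exists j, bad (at_ j x)].
  apply: (@le_trans _ _ (2 * M ^+ k)).
    apply: le_trans (ler_normB _ _) _.
    by have := pM (fun j => blk (at_ j x)); have := pM (fun j => y (u j)); rewrite /at_; lra.
  rewrite ler_peMr ?mulr_ge0 // (bigD1 j) //= -/(at_ j x) jb lerDl.
  by apply: sumr_ge0 => i _; rewrite ler0n.
rewrite (_ : \prod_j _ = \prod_j f (y (u j))); last first.
  apply: eq_bigr => j _; rewrite (Jdet x y (u j) Jn (cov (u j))) //.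
  by apply: contra nb => bj; apply/existsP; exists j.
by rewrite subrr normr0 !mulr_ge0 // sumr_ge0.
Qed.

(** * Discrepancies, their fluctuation and the tilt *)

Variable h : R.
(** [lp] and [lq] are the centered information functions [g] and [f] of the overview. *)
Let lp a := - ln (p a) - h.
Let lq b := - ln (q b) - h.
Hypotheses (entp : \sum_a p a * lp a = 0) (entq : \sum_b q b * lq b = 0).
Hypotheses (lp_le : forall a, `|lp a| <= M) (lq_le : forall b, `|lq b| <= M).
Variable eps : R.
Hypothesis bad_eps : EZ m (fun x => (bad x)%:R) <= eps.

Definition discrep (x : Zd d -> A) : R := lq (blk x) - lp (x 0).

(** The sum of the [D_u] over the sites [u] whose window contains 0, that is, over all that the
    symbol at 0 can affect. [fluct0] is then the effect of resampling that symbol, and [kappa] its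
    L1 norm. *)
Definition fluct (x : Zd d -> A) : R :=
  \sum_(s : 'rV['I_(2 * m).+1]_d) discrep (Defs.shift (emb (- m%:Z) s) x).

Definition fluct0 (x : Zd d -> A) : R := fluct x - avg p 0 fluct x.

Definition kappa : R := EZ (2 * m) (fun x => `|fluct0 x|).

Definition tiltarg (x : Zd d -> A) : R := Num.sg (fluct0 x).

(** The density of a tilt at 0 towards large [fluct]. Centering gives it conditional mean 1 over the
    symbol at 0, and the divisor 4 keeps it within 1/2 of 1. *)
Definition tilt (x : Zd d -> A) : R := 1 + (tiltarg x - avg p 0 tiltarg x) / 4.

Lemma inball0 K : inball K (0 : Zd d).
Proof. by apply/forallP => i; rewrite mxE. Qed.

Lemma inball_opp K (s : Zd d) : inball K s -> inball K (- s).
Proof.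
by move=> /forallP sK; apply/forallP => i; rewrite mxE normrN; exact: sK.
Qed.

Lemma discrep_local : local_on m discrep.
Proof. by move=> x x' xx'; rewrite /discrep (blk_loc xx') xx' ?inball0. Qed.

Lemma fluct_local : local_on (2 * m) fluct.
Proof.
move=> x x' xx'; apply: eq_bigr => s _.
exact: (local_shift (emb_inball s) discrep_local xx').
Qed.

Lemma fluct0_local : local_on (2 * m) fluct0.
Proof.
by move=> x x' xx'; rewrite /fluct0 (fluct_local xx') (local_avg 0 fluct_local xx').
Qed.

Lemma tiltarg_local : local_on (2 * m) tiltarg.
Proof. by move=> x x' xx'; rewrite /tiltarg (fluct0_local xx'). Qed.

Lemma tilt_local : local_on (2 * m) tilt.
Proof.
by move=> x x' xx'; rewrite /tilt (tiltarg_local xx') (local_avg 0 tiltarg_local xx').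
Qed.

Lemma avg_cst (J : eqType) (i : J) (e : R) x : avg p i (fun=> e) x = e.
Proof. by rewrite /avg -mulr_suml p_sum1 mul1r. Qed.

Lemma tilt_bounds x : 2^-1 <= tilt x <= 3 / 2.
Proof.
have sg1 y : `|tiltarg y| <= 1.
  rewrite /tiltarg normr_sg; by case: (_ != 0).
have a1 : `|avg p 0 tiltarg x| <= 1.
  apply: le_trans (ler_norm_sum _ _ _) _; rewrite -[leRHS]p_sum1.
  by apply: ler_sum => a _; rewrite normrM ger0_norm // ler_piMr.
have := sg1 x; move: a1; rewrite /tilt !ler_norml => /andP[? ?] /andP[? ?].
by apply/andP; split; lra.
Qed.

Lemma tilt_gt0 x : 0 < tilt x.
Proof. by have /andP[? _] := tilt_bounds x; lra. Qed.

Lemma avg_avg0 (H : (Zd d -> A) -> R) x : avg p 0 (avg p 0 H) x = avg p 0 H x.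
Proof.
rewrite -[RHS](avg_cst 0 (avg p 0 H x) x) /avg.
by apply: eq_bigr => a _; congr (_ * _); apply: eq_bigr => b _; rewrite upd_upd.
Qed.

Lemma avg_tilt x : avg p 0 tilt x = 1.
Proof.
rewrite /tilt; have -> : avg p 0 (fun x => 1 + (tiltarg x - avg p 0 tiltarg x) / 4) x =
   1 + (avg p 0 tiltarg x - avg p 0 (avg p 0 tiltarg) x) / 4.
  transitivity (\sum_a (p a + (p a * tiltarg (upd x 0 a) -
      p a * avg p 0 tiltarg (upd x 0 a)) / 4)).
    by apply: eq_bigr => a _; ring.
  by rewrite big_split /= -mulr_suml sumrB p_sum1.
by rewrite avg_avg0 subrr mul0r addr0.
Qed.

(** Self-adjointness of conditional expectation, in the form of pulling out a factor independent of
    the symbol at 0. *)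
Lemma EZ_mul_avg0 K (H G : (Zd d -> A) -> R) :
  EZ K (fun x => avg p 0 H x * G x) = EZ K (fun x => avg p 0 H x * avg p 0 G x).
Proof.
rewrite -EZ_avg0; apply: eq_Ex => x; rewrite {2}/avg mulr_sumr.
by apply: eq_bigr => a _; rewrite mulrCA /avg; under eq_bigr do rewrite upd_upd.
Qed.

(** By self-adjointness the centering moves from [tiltarg] to [fluct]; the sign of [fluct0] times
    [fluct0] is its absolute value, whose mean is [kappa]. *)
Lemma EZ_tilt : EZ (2 * m) (fun x => tilt x * fluct x) = EZ (2 * m) fluct + kappa / 4.
Proof.
have -> : EZ (2 * m) (fun x => tilt x * fluct x) = EZ (2 * m) fluct +
    4^-1 * (EZ (2 * m) (fun x => tiltarg x * fluct x) -
            EZ (2 * m) (fun x => avg p 0 tiltarg x * fluct x)).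
  by rewrite /EZ -ExB -ExZ -ExD; apply: eq_Ex => x; rewrite /tilt; ring.
congr (_ + _); rewrite mulrC; congr (_ / _).
rewrite EZ_mul_avg0.
have -> : EZ (2 * m) (fun x => avg p 0 tiltarg x * avg p 0 fluct x) =
    EZ (2 * m) (fun x => tiltarg x * avg p 0 fluct x).
  transitivity (EZ (2 * m) (fun x => avg p 0 fluct x * tiltarg x)); last first.
    by apply: eq_Ex => x; rewrite mulrC.
  by rewrite [RHS]EZ_mul_avg0; apply: eq_Ex => x; rewrite mulrC.
rewrite /kappa /EZ -ExB; apply: eq_Ex => x.
by rewrite -mulrBr -/(fluct0 _) [RHS]normrEsg.
Qed.

(** Both information functions have mean zero, so only bad windows contribute: this is
    [moment_bound] with [k = 1] at the single site 0. *)
Lemma EZ_discrep : `|EZ m discrep| <= 2 * M * eps.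
Proof.
have z0 : emb (- m%:Z) (unemb (2 * m) (- m%:Z) 0) = 0 :> Zd d.
  by apply: unembK => i; rewrite mxE; lia.
have -> : EZ m discrep = EZ m (fun x => lq (blk x)).
  rewrite -[RHS]subr0 -entp -(Ex_coord p_sum1 (unemb (2 * m) (- m%:Z) (0 : Zd d)) lp) -ExB.
  apply: eq_Ex => x; rewrite /discrep -[in ext _ _ _ 0]z0 extE //; exact: emb_inj.
have sh0 (x : Zd d -> A) : Defs.shift 0 x = x.
  by apply/funext => u; rewrite /Defs.shift addr0.
have cov (u : unit) (v : Zd d) : inball m v ->
    exists i : 'rV['I_(2 * m).+1]_d, emb (- m%:Z) i = v + 0.
  by move=> /inball_emb[z <-]; exists z; rewrite addr0.
have := moment_bound (fun _ : 'I_1 => tt) (f := lq) (@emb_inj d (2 * m).+1 (- m%:Z))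
  (iota' := fun _ : unit => 0) _ cov lq_le.
move=> /(_ (fun u v _ => match u, v with tt, tt => erefl end)).
rewrite expr1 big_ord1.
have -> : Ex q (fun y : unit -> B => \prod_(j < 1) lq (y tt)) = 0.
  rewrite -[RHS]entq -[RHS](Ex_coord q_sum1 tt); apply: eq_Ex => y; exact: big_ord1.
set X := Ex p _; have -> : X = EZ m (fun x => lq (blk x)).
  by apply: eq_Ex => x; rewrite big_ord1 sh0.
set Y := Ex p _; have -> : Y = EZ m (fun x => (bad x)%:R).
  by apply: eq_Ex => x; rewrite sh0.
rewrite subr0 => H; apply: le_trans H _; apply: ler_wpM2l bad_eps.
by rewrite mulr_ge0 //; apply: le_trans (lq_le b0); rewrite normr_ge0.
Qed.

Lemma EZ_fluct : `|EZ (2 * m) fluct| <= (2 * m).+1%:R ^+ d * (2 * M * eps).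
Proof.
have -> : EZ (2 * m) fluct = (2 * m).+1%:R ^+ d * EZ m discrep.
  rewrite /EZ /fluct Ex_sum.
  transitivity (\sum_(s : 'rV['I_(2 * m).+1]_d) EZ m discrep).
    apply: eq_bigr => s _; exact: (EZ_shift (emb_inball s) discrep_local).
  by rewrite sumr_const -[LHS]mulr_natl card_mx card_ord mul1n natrX.
rewrite normrM ger0_norm ?exprn_ge0 //; apply: ler_wpM2l EZ_discrep.
by rewrite exprn_ge0.
Qed.

(** * Simultaneous tilting at the centers of a sparse lattice *)

Section Cells.
Variable k : nat.
Let r := (2 * m).+1.

(* The cubes of side [r] around the centers tile the box [r, (k+1)r)^d, inside
   the larger box [0, (k+2)r)^d. *)
Definition center (c : 'rV['I_k]_d) : Zd d :=
  \row_i ((r * (c ord0 i).+1 + m)%N%:Z).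

(** Distinct centers differ by at least [2 m + 1] in some coordinate. So the window of radius [2 m]
    read by one tilt contains no other center, even though these windows may overlap. *)
Lemma center_far (c c' : 'rV['I_k]_d) (s : Zd d) : c != c' -> inball (2 * m) s ->
  s + center c != center c'.
Proof.
move=> cc' /forallP sK; have [i ci] : exists i, c ord0 i != c' ord0 i.
  apply/existsP; apply: contraNT cc'; rewrite negb_exists => /forallP H.
  by apply/eqP/rowP => i; have := H i; rewrite negbK => /eqP.
apply/eqP => /rowP/(_ i); rewrite !mxE; have := sK i.
have : (c ord0 i : nat) <> c' ord0 i by move/val_inj/eqP; apply/negP.
move: (s _ _) (c ord0 i : nat) (c' ord0 i : nat) => z a b ab; rewrite ler_norml /r.
have [lt|ge] := ltnP a b.
  rewrite -(subnKC lt); move: (b - a.+1)%N => e; nia.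
have {ge ab} lt : (b < a)%N by lia.
rewrite -(subnKC lt); move: (a - b.+1)%N => e; nia.
Qed.

Let n0 := ((k.+2 * r).-1)%N.
Let box := 'rV['I_n0.+1]_d.
Let at_ (x : box -> A) : Zd d -> A := ext a0 (emb 0) x.

Lemma box_range (u : Zd d) :
  (forall i, 0 <= u ord0 i < (k.+2 * r)%N%:Z) -> exists z : box, emb 0 z = u.
Proof.
move=> H; exists (unemb n0 0 u); apply: unembK => i; have := H i.
by move: (u _ _) => a; rewrite /n0 /r; lia.
Qed.

Lemma center_box (c : 'rV['I_k]_d) (s : Zd d) i : inball (2 * m) s ->
  0 <= (s + center c) ord0 i < (k.+2 * r)%N%:Z.
Proof.
move=> /forallP/(_ i); rewrite !mxE ler_norml; have := ltn_ord (c ord0 i).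
move: (s _ _) (c ord0 i : nat) => z a; rewrite /r => ak.
have : (a.+2 <= k.+1)%N by lia.
move: (k.+1) => K; rewrite -[(K.+1 * _)%N]/((2 * m).+1 + K * (2 * m).+1)%N => aK.
rewrite -(subnKC aK); move: (K - a.+2)%N => e; nia.
Qed.

(** Integrate out the symbols at the centers in [L] one after another: the symbol at [c] enters only
    the tilt at [c], which has conditional mean 1. *)
Lemma Ex_drop_tilts (H : (Zd d -> A) -> R) (L : seq 'rV['I_k]_d) : uniq L ->
  (forall c x a, c \in L -> H (upd x (center c) a) = H x) ->
  Ex p (fun x => H (at_ x) * \prod_(c <- L) tilt (Defs.shift (center c) (at_ x))) =
  Ex p (fun x => H (at_ x)).
Proof.
elim: L => [|c L IH] /=; first by move=> _ _; apply: eq_Ex => x; rewrite big_nil mulr1.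
move=> /andP[cL uL] HL; rewrite -IH //; last by move=> c' x a c'L; apply: HL; rewrite inE c'L orbT.
have [z zE] : exists z : box, emb 0 z = center c.
  apply: box_range => i; rewrite -[center c]add0r; apply: center_box; exact: inball0.
have upd_at x a : at_ (upd x z a) = upd (at_ x) (center c) a.
  by rewrite /at_ ext_upd ?zE //; exact: emb_inj.
rewrite -[RHS](Ex_indep_mul p_sum1 (i := z)
  (g := fun x => tilt (Defs.shift (center c) (at_ x)))).
- by apply: eq_Ex => x; rewrite big_cons mulrCA [LHS]mulrC.
- move=> x a; rewrite upd_at; congr (_ * _); first exact: HL (mem_head _ _).
  rewrite big_seq [RHS]big_seq; apply: eq_bigr => c' c'L; apply: tilt_local => s sK.
  rewrite /Defs.shift /upd ifN //; apply: center_far => //.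
  by apply: contraTneq c'L => ->.
- move=> x; rewrite -[RHS](avg_tilt (Defs.shift (center c) (at_ x))).
  by apply: eq_bigr => a _; rewrite upd_at shift_upd.
Qed.

Let W (x : box -> A) : R := \prod_c tilt (Defs.shift (center c) (at_ x)).

Lemma Ex_W : Ex p W = 1.
Proof.
rewrite -[RHS](Ex_cst p_sum1 box) -[RHS](Ex_drop_tilts (H := fun=> 1) (L := enum 'rV['I_k]_d)) //.
  by apply: eq_Ex => x; rewrite mul1r big_enum.
exact: enum_uniq.
Qed.

Lemma Ex_W_cell (c : 'rV['I_k]_d) (H : (Zd d -> A) -> R) : local_on (2 * m) H ->
  Ex p (fun x => W x * H (Defs.shift (center c) (at_ x))) =
  EZ (2 * m) (fun x => tilt x * H x).
Proof.
move=> HK.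
have tHK : local_on (2 * m) (fun x => tilt x * H x).
  by move=> x x' xx'; rewrite (tilt_local xx') (HK _ _ xx').
pose H' y := tilt (Defs.shift (center c) y) * H (Defs.shift (center c) y).
transitivity (Ex p (fun x => H' (at_ x))).
  rewrite -(Ex_drop_tilts (H := H') (L := [seq c' <- enum 'rV['I_k]_d | c' != c])).
  - apply: eq_Ex => x; rewrite /W (bigD1 c) //= big_filter big_enum_cond /=.
    by rewrite mulrAC.
  - by rewrite filter_uniq // enum_uniq.
  - move=> c' x a; rewrite mem_filter => /andP[c'c _].
    apply: tHK => s sK; rewrite /Defs.shift /upd ifN //.
    by apply: center_far => //; rewrite eq_sym.
apply: (transfer_box tHK) => s sK i; have := center_box c i sK.
by move: (_ ord0 i) => a; rewrite /n0 /r; lia.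
Qed.

Let site (u : 'rV['I_k]_d * 'rV['I_r]_d) : Zd d := emb (- m%:Z) u.2 + center u.1.

Lemma site_inj : injective site.
Proof.
move=> [c s] [c' s']; rewrite /site /= => E.
have [cc'|cc'] := eqVneq c c'.
  by move: E; rewrite cc' => /addIr /emb_inj ->.
have : inball (2 * m) (emb (- m%:Z) s - emb (- m%:Z) s').
  by rewrite mul2n -addnn inball_add ?inball_opp // emb_inball.
by move=> /(center_far cc'); rewrite addrAC E addrAC subrr add0r eqxx.
Qed.

Lemma site_cover u v : inball m v -> exists z : box, emb 0 z = v + site u.
Proof.
move=> vm; rewrite /site addrA; apply: box_range => i; apply: center_box.
by rewrite mul2n -addnn; apply: inball_add => //; exact: emb_inball.
Qed.

(** The same [h] centers [lq] and [lp], so it cancels, and the cells together list every [site]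
    once. *)
Lemma sum_discrep (y : Zd d -> A) :
  \sum_c fluct (Defs.shift (center c) y) =
  \sum_u (ln (p (y (site u))) - ln (q (blk (Defs.shift (site u) y)))).
Proof.
rewrite -(pair_bigA _ (fun c s => ln (p (y (site (c, s)))) -
  ln (q (blk (Defs.shift (site (c, s)) y))))) /=.
apply: eq_bigr => c _; apply: eq_bigr => s _.
rewrite /discrep /lq /lp.
have -> : Defs.shift (emb (- m%:Z) s) (Defs.shift (center c) y) =
    Defs.shift (site (c, s)) y.
  by apply/funext => u; rewrite /Defs.shift /site addrA.
have -> : Defs.shift (site (c, s)) y 0 = y (site (c, s)).
  by rewrite /Defs.shift add0r.
ring.
Qed.

(** The difference of powers counts the points of the box outside the cells; each contributes at
    least [- M] to the sum of [ln p]. *)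
Lemma log_weight_ge (x : box -> A) :
  \sum_c fluct (Defs.shift (center c) (at_ x)) -
    M * ((k.+2 * r)%:R ^+ d - (k * r)%:R ^+ d) <=
  \sum_z ln (p (x z)) - \sum_u ln (q (blk (Defs.shift (site u) (at_ x)))).
Proof.
have jE u : {z : box | emb 0 z = site u}.
  apply: cid; have [z zE] := site_cover u (inball0 m).
  by exists z; rewrite zE add0r.
pose j u := sval (jE u).
have jI : injective j.
  by move=> u v uv; apply: site_inj; rewrite -(svalP (jE u)) -(svalP (jE v)) -/(j u) uv.
rewrite sum_discrep sumrB.
rewrite addrAC lerD2r lerBlDr.
rewrite [in leRHS](bigID (mem (j @: {: 'rV['I_k]_d * 'rV['I_r]_d}))) /=.
rewrite big_imset /=; last by move=> u v _ _; exact: jI.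
rewrite -addrA -[leLHS]addr0; apply: lerD.
  rewrite le_eqVlt; apply/orP; left; apply/eqP; apply: eq_bigr => u _.
  by rewrite /at_ -(svalP (jE u)) extE //; exact: emb_inj.
have -> : (k.+2 * r)%:R ^+ d - (k * r)%:R ^+ d =
    \sum_(z | z \notin j @: {: 'rV['I_k]_d * 'rV['I_r]_d}) (1 : R).
  have : \sum_(z : box) (1 : R) = (k.+2 * r)%:R ^+ d.
    by rewrite sumr_const card_mx card_ord mul1n -natrX.
  rewrite (bigID (mem (j @: {: 'rV['I_k]_d * 'rV['I_r]_d}))) /= => <-.
  rewrite sumr_const card_imset // card_prod !card_mx !card_ord !mul1n.
  by rewrite -expnMn natrX addrAC subrr add0r.
rewrite mulr_sumr -big_split /=; apply: sumr_ge0 => z _.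
by have := lnp_le (x z); rewrite ler_norml => /andP[? _]; lra.
Qed.

(** [entropy_bound] for the law tilted at all [k ^ d] centers: by [EZ_tilt] each cell gains
    [kappa / 4], against a boundary term and the cost of bad windows. *)
Lemma cells_bound (del : R) : 0 < del -> del <= 2^-1 ->
  k%:R ^+ d * (EZ (2 * m) fluct + kappa / 4) -
    M * ((k.+2 * r)%:R ^+ d - (k * r)%:R ^+ d) <=
  (k * r)%:R ^+ d * (2 * del + (2 * M + ln (#|B|%:R / del)) * (3 / 2 * eps)).
Proof.
move=> del0 del2.
have W0 x : 0 < W x by apply: prodr_gt0 => c _; exact: tilt_gt0.
have := entropy_bound (@emb_inj d n0.+1 0) site_inj site_cover W0 Ex_W del0 del2.
move=> H; apply: le_trans (le_trans _ H) _ => {H}.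
  apply: (@le_trans _ _ (Ex p (fun x => W x *
    (\sum_c fluct (Defs.shift (center c) (at_ x)) -
      M * ((k.+2 * r)%:R ^+ d - (k * r)%:R ^+ d))))); last first.
    by apply: ler_Ex => // x; rewrite ler_pM2l //; exact: log_weight_ge.
  rewrite le_eqVlt; apply/orP; left; apply/eqP.
  transitivity (Ex p (fun x => \sum_c W x * fluct (Defs.shift (center c) (at_ x)) -
      M * ((k.+2 * r)%:R ^+ d - (k * r)%:R ^+ d) * W x)); last first.
    by apply: eq_Ex => x; rewrite -mulr_sumr; ring.
  rewrite ExB ExZ Ex_W mulr1 Ex_sum; congr (_ - _).
  under eq_bigr => c _ do rewrite (Ex_W_cell c fluct_local) EZ_tilt.
  by rewrite sumr_const card_mx card_ord mul1n -[RHS]mulr_natl natrX.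
have L0 : 0 <= ln (#|B|%:R / del).
  have cB1 : 1 <= #|B|%:R :> R by rewrite ler1n; apply/card_gt0P; exists b0.
  by rewrite ln_ge0 // ler_pdivlMr // mul1r; lra.
have M0 : 0 <= M by apply: le_trans (lq_le b0); rewrite normr_ge0.
rewrite card_prod !card_mx !card_ord !mul1n -expnMn natrX mulrDr lerD2l.
rewrite mulrCA; apply: ler_wpM2l; first by lra.
(* The tilts at other centers integrate out and the remaining one is at most 3/2. *)
have bound u : Ex p (fun x => W x * (bad (Defs.shift (site u) (at_ x)))%:R) <= 3 / 2 * eps.
  case: u => c s.
  pose bs (x : Zd d -> A) : R := (bad (Defs.shift (emb (- m%:Z) s) x))%:R.
  have bs_loc : local_on (2 * m) bs.
    by apply: (local_shift (emb_inball s) (H := fun x => (bad x)%:R)) => x x' /bad_loc ->.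
  have -> : Ex p (fun x => W x * (bad (Defs.shift (site (c, s)) (at_ x)))%:R) =
      EZ (2 * m) (fun x => tilt x * bs x).
    rewrite -(Ex_W_cell c bs_loc); apply: eq_Ex => x; congr (_ * (nat_of_bool (bad _))%:R).
    by apply/funext => u; rewrite /Defs.shift /site addrA.
  apply: (@le_trans _ _ (3 / 2 * EZ (2 * m) bs)).
    rewrite /EZ -ExZ; apply: ler_Ex => // x; apply: ler_wpM2r; first by rewrite ler0n.
    by have /andP[] := tilt_bounds (ext a0 (emb (- (2 * m)%N%:Z)) x).
  apply: ler_wpM2l; first by lra.
  rewrite (EZ_shift (emb_inball s) (H := fun x => (bad x)%:R)) // => x x' /bad_loc -> //.
apply: le_trans (ler_sum _ (fun u _ => bound u)) _.
by rewrite sumr_const card_prod !card_mx !card_ord !mul1n -expnMn -[leLHS]mulr_natl natrX.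
Qed.

End Cells.

(** Divide [cells_bound] by [k ^ d] and let [k] grow: the boundary disappears and the gain per cell
    cannot exceed the cost per cell. The mean of [fluct] is absorbed by [EZ_fluct]. *)
Lemma kappa_bound (del : R) : 0 < del -> del <= 2^-1 ->
  kappa <= 4 * (2 * m).+1%:R ^+ d *
    (2 * del + (2 * M + ln (#|B|%:R / del)) * (3 / 2 * eps) + 2 * M * eps).
Proof.
move=> del0 del2.
have M0 : 0 <= M by apply: le_trans (lq_le b0); rewrite normr_ge0.
pose r := (2 * m).+1%:R : R.
have r0 : 0 < r by rewrite ltr0n.
pose Q := 2 * del + (2 * M + ln (#|B|%:R / del)) * (3 / 2 * eps).
pose X := EZ (2 * m) fluct + kappa / 4 - r ^+ d * Q.
suff X0 : X <= 0.
  have := EZ_fluct; rewrite ler_norml -/r => /andP[? _].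
  rewrite -/Q -/r; move: X0; rewrite /X -/r => X0.
  have -> : 4 * r ^+ d * (Q + 2 * M * eps) = 4 * (r ^+ d * Q + r ^+ d * (2 * M * eps)) by ring.
  by lra.
have H k : k%:R ^+ d * X <= M * r ^+ d * (k.+2%:R ^+ d - k%:R ^+ d).
  have := cells_bound k del0 del2; rewrite -/Q !natrM !exprMn -/r /X => H.
  by rewrite -subr_ge0; move: H; rewrite -subr_ge0; congr (0 <= _); ring.
rewrite leNgt; apply/negP => Xp.
have Y0 : 0 <= M * r ^+ d by rewrite mulr_ge0 // exprn_ge0 // ltW.
(* In dimension 0 the boundary term vanishes outright; otherwise [d.-1] is a true predecessor. *)
case: (posnP d) => [d0|d_gt0].
  by have := H 1%N; rewrite d0 !expr0 subrr mulr0 mul1r leNgt Xp.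
(* [(k+2)^d - k^d <= 2 d (2 k)^(d-1)] is of lower order than [k^d] *)
have dif k : (2 <= k)%N -> k.+2%:R ^+ d - k%:R ^+ d <= 2 * (d%:R * (2 * k%:R) ^+ d.-1) :> R.
  move=> k2; rewrite subrXX; apply: ler_pM.
  - by rewrite subr_ge0 ler_nat; lia.
  - by apply: sumr_ge0 => i _; rewrite mulr_ge0 ?exprn_ge0.
  - by rewrite -natrB; [rewrite ler_nat; lia|lia].
  have <- : \sum_(i < d) (2 * k%:R) ^+ d.-1 = d%:R * (2 * k%:R) ^+ d.-1 :> R.
    by rewrite sumr_const card_ord [RHS]mulr_natl.
  apply: ler_sum => i _.
  have -> : (2 * k%:R : R) ^+ d.-1 = (2 * k%:R) ^+ (d.-1 - i) * (2 * k%:R) ^+ i.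
    by rewrite -exprD; congr (_ ^+ _); have := ltn_ord i; lia.
  apply: ler_pM; rewrite ?exprn_ge0 //.
    rewrite -subn1 -subnDA add1n subnS.
    have -> : (d - i).-1 = (d.-1 - i)%N by lia.
    by apply: lerXn2r; rewrite ?nnegrE ?mulr_ge0 // -natrM ler_nat; lia.
  by apply: lerXn2r; rewrite ?nnegrE ?mulr_ge0 // -natrM ler_nat; lia.
pose Z := M * r ^+ d * (2 * (d%:R * 2 ^+ d.-1)).
have Z0 : 0 <= Z by rewrite /Z !mulr_ge0 // ?exprn_ge0.
have Hk k : (2 <= k)%N -> k%:R * X <= Z.
  move=> k2; have kp : 0 < k%:R ^+ d.-1 :> R by rewrite exprn_gt0 // ltr0n; lia.
  rewrite -(ler_pM2l kp) mulrA -exprSr prednK //; apply: le_trans (H k) _.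
  apply: le_trans (ler_wpM2l Y0 (dif k k2)) _.
  by rewrite /Z exprMn le_eqVlt; apply/orP; left; apply/eqP; ring.
have := archi_boundP (divr_ge0 Z0 (ltW Xp)); set N := Num.Def.archi_bound _ => HN.
have := Hk (maxn 2 N); rewrite leq_maxl => /(_ isT); rewrite leNgt => /negP; apply.
rewrite -ltr_pdivrMr //; apply: lt_le_trans HN _; by rewrite ler_nat leq_maxr.
Qed.

(** * Moments on the torus *)

Section Torus.
Variable n : nat.
Hypothesis mn : (4 * m < n.+2)%N.
(** The side has the form [n.+2] so that ['I_n.+2] is a ring. By [mn], balls of radius [2 m] embed
    in the torus. *)
Let T := 'rV['I_n.+2]_d.

Definition red (u : Zd d) : T := map_mx (fun z : int => z%:~R) u.

(** The periodic configuration on Z^d unrolled from [x] and seen from [u]. *)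
Definition lift (u : T) (x : T -> A) : Zd d -> A := fun v => x (u + red v).

Lemma redD u v : red (u + v) = red u + red v.
Proof. by apply/rowP => i; rewrite !mxE intrD. Qed.

Lemma redN u : red (- u) = - red u.
Proof. by apply/rowP => i; rewrite !mxE intrN. Qed.

Lemma red0 : red 0 = 0.
Proof. by apply/rowP => i; rewrite !mxE. Qed.

Lemma red_emb (w : T) : red (emb 0 w) = w.
Proof.
apply/rowP => i; rewrite !mxE addr0 -pmulrn Zp_nat; apply: val_inj.
by rewrite /= modn_small.
Qed.

Lemma red_eq0 (u : Zd d) : inball (4 * m) u -> red u = 0 -> u = 0.
Proof.
have nat0 (z : nat) : (z <= 4 * m)%N -> (z%:R : 'I_n.+2) = 0 -> z = 0%N.
  move=> zm /(congr1 val); rewrite Zp_nat /= modn_small //.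
  exact: leq_ltn_trans zm mn.
move=> /forallP uK /rowP u0; apply/rowP => i; have := u0 i; have := uK i.
rewrite !mxE; case: (u _ _) => z.
  by rewrite -pmulrn => zm /nat0 -> //; lia.
rewrite NegzE intrN -pmulrn => zm /eqP; rewrite oppr_eq0 => /eqP /nat0 E.
by have : z.+1 = 0%N by apply: E; lia.
Qed.

Lemma red_inj K : (K <= 2 * m)%N -> {in inball K &, injective red}.
Proof.
move=> Km s t sK tK E; apply/eqP; rewrite -subr_eq0; apply/eqP/red_eq0.
  have := inball_add sK (inball_opp tK); move=> /forallP H; apply/forallP => i.
  by apply: le_trans (H i) _; rewrite lez_nat; lia.
by rewrite redD redN E subrr.
Qed.

Lemma lift_shift u s x : lift (u + red s) x = Defs.shift s (lift u x).
Proof. by apply/funext => v; rewrite /lift /Defs.shift redD addrAC addrA. Qed.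

Lemma transfer_torus K u (H : (Zd d -> A) -> R) : (K <= 2 * m)%N -> local_on K H ->
  Ex p (fun x => H (lift u x)) = EZ K H.
Proof.
move=> Km HK; apply: (transfer (tau := fun s => u + red s)) => // s t sK tK /addrI E.
exact: (red_inj Km sK tK E).
Qed.

Lemma lift_upd v x a : forall i, inball (2 * m) i ->
  lift v (upd x v a) i = upd (lift v x) 0 a i.
Proof.
move=> i iK; rewrite /lift /upd -[X in _ == X]addr0 (inj_eq (addrI v)).
have [->|i0] := eqVneq i 0; first by rewrite red0 eqxx.
case: eqP => // /red_eq0 E; case/eqP: i0; apply: E; apply/forallP => j.
by apply: le_trans (forallP iK j) _; rewrite lez_nat; lia.
Qed.

Definition torus_discrep (x : T -> A) : R := \sum_u discrep (lift u x).

(** Resampling the symbol at [v] affects only the sites whose window contains [v]; these form an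
    embedded ball around [v], where the sum of discrepancies is [fluct]. *)
Lemma torus_discrep_avg v x :
  torus_discrep x - avg p v torus_discrep x = fluct0 (lift v x).
Proof.
have avgD (J : eqType) (I : finType) (i : J) (H : I -> (J -> A) -> R) y :
    avg p i (fun z => \sum_u H u z) y = \sum_u avg p i (H u) y.
  by rewrite /avg; under eq_bigr do rewrite mulr_sumr; rewrite exchange_big.
rewrite /fluct0 /fluct /torus_discrep !avgD -!sumrB.
pose j (s : 'rV['I_(2 * m).+1]_d) : T := v + red (emb (- m%:Z) s).
have jI : injective j.
  move=> s t /addrI E; apply: (@emb_inj d (2 * m).+1 (- m%:Z)).
  by apply: (@red_inj m) E; [lia|exact: emb_inball|exact: emb_inball].
rewrite (bigID (mem (j @: {: 'rV['I_(2 * m).+1]_d}))) /= [X in _ + X]big1 ?addr0.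
  rewrite big_imset /=; last by move=> s t _ _; exact: jI.
  apply: eq_bigr => s _; rewrite /j lift_shift; congr (_ - _).
  apply: eq_bigr => a _; rewrite lift_shift; congr (_ * _).
  exact: (local_shift (emb_inball s) discrep_local (lift_upd v x a)).
move=> u un; apply/eqP; rewrite subr_eq0 eq_sym; apply/eqP.
rewrite -[RHS](avg_cst v (discrep (lift u x)) x); apply: eq_bigr => a _; congr (_ * _).
apply: discrep_local => t tm; rewrite /lift /upd; case: eqP => // E.
case/negP: un; have [s sE] := inball_emb (inball_opp tm).
apply/imsetP; exists s => //; by rewrite /j sE redN -E addrK.
Qed.

(** In the L1 Efron-Stein inequality every coordinate contributes [kappa]; the mean adds at most
    [2 * M * eps] per site. *)
Lemma torus_discrep_L1 :
  Ex p (fun x => `|torus_discrep x|) <= n.+2%:R ^+ d * (kappa + 2 * M * eps).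
Proof.
apply: (@le_trans _ _ (Ex p (fun x => `|torus_discrep x - Ex p torus_discrep|) +
    `|Ex p torus_discrep|)).
  rewrite -[X in _ + X](Ex_cst p_sum1 T) -ExD; apply: ler_Ex => // x.
  by rewrite -{1}[torus_discrep x](subrK (Ex p torus_discrep)) ler_normD.
have cT : #|{: T}|%:R = n.+2%:R ^+ d :> R by rewrite card_mx card_ord mul1n natrX.
rewrite mulrDr; apply: lerD.
  apply: le_trans (Ex_norm_centered p_ge0 p_sum1 _) _.
  rewrite le_eqVlt; apply/orP; left; apply/eqP.
  transitivity (\sum_(v : T) kappa); last by rewrite sumr_const -[LHS]mulr_natl cT.
  apply: eq_bigr => v _; rewrite /kappa.
  have nl : local_on (2 * m) (fun x => `|fluct0 x|) by move=> x x' /fluct0_local ->.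
  rewrite -(transfer_torus v (leqnn _) nl).
  by apply: eq_Ex => x; rewrite torus_discrep_avg.
rewrite /torus_discrep Ex_sum -cT.
apply: le_trans (ler_norm_sum _ _ _) _.
rewrite mulr_natl -sumr_const; apply: ler_sum => u _.
rewrite (transfer_torus u _ discrep_local); last lia.
exact: EZ_discrep.
Qed.

Lemma M_ge0 : 0 <= M.
Proof. by apply: le_trans (lq_le b0); rewrite normr_ge0. Qed.

Variable k : nat.
Hypothesis kn : (k.+1 * (2 * m) < n.+2)%N.
Hypothesis low : forall l, (l < k.+1)%N ->
  \sum_a p a * lp a ^+ l = \sum_b q b * lq b ^+ l.
Let Delta := \sum_b q b * lq b ^+ k.+1 - \sum_a p a * lp a ^+ k.+1.

(* Translating by [c], the torus is cut open away from the windows of the sites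
   [u j], so that these windows lift to a box of Z^d. *)
Lemma torus_tuple (u : 'I_k.+1 -> T) :
  `|Ex p (fun x => \prod_j lq (blk (lift (u j) x))) -
    Ex p (fun x : T -> A => \prod_j lp (x (u j))) -
    [forall j, u j == u ord0]%:R * Delta| <= 2 * M ^+ k.+1 * (k.+1%:R * eps).
Proof.
have gap i : {z : 'I_n.+2 | forall j, (m <= (u j ord0 i - z)%R < n.+2 - m)%N}.
  by apply: cid; apply: (cyclic_gap (fun j => u j ord0 i)).
pose c : T := \row_i sval (gap i).
(* The positions whose window of radius [m] does not cross the cut. *)
pose inner (w : T) : bool := [forall i, m <= w ord0 i < n.+2 - m]%N.
have uin j : inner (u j - c).
  by apply/forallP => i; rewrite !mxE; exact: (svalP (gap i)).
pose I' : finType := {w : T | inner w}.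
pose u' j : I' := Sub (u j - c) (uin j).
pose iota' (w : I') : Zd d := emb 0 (val w).
have iI' : injective iota' by move=> w w' /emb_inj /val_inj.
have range (w : I') v : inball m v -> forall i, 0 <= (v + iota' w) ord0 i <= 0 + n.+1%:Z.
  move=> /forallP vm i; have /forallP/(_ i) := valP w; have := vm i.
  rewrite !mxE ler_norml /=.
  by move: (v _ _) (val w ord0 i : nat) => z a; lia.
have cov (w : I') v : inball m v -> exists z : T, emb 0 z = v + iota' w.
  by move=> vm; exists (unemb n.+1 0 (v + iota' w)); apply: unembK; exact: range.
(* After translation by [c], the wrapped window around [u j] becomes a genuine window in the box. *)
have lift_box x j v : inball m v ->
    lift (u j) x v = Defs.shift (iota' (u' j)) (ext a0 (emb 0) (x \o +%R c)) v.
  move=> vm; have [z zE] := cov (u' j) v vm.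
  rewrite /Defs.shift -zE extE; last exact: emb_inj.
  rewrite /= /lift; congr x; rewrite -[z]red_emb zE redD /iota' /= red_emb.
  by rewrite addrCA [c + _]addrC subrK addrC.
have c_inj : injective (+%R c) by exact: addrI.
have -> : Ex p (fun x => \prod_j lq (blk (lift (u j) x))) =
    Ex p (fun x : T -> A =>
      \prod_j lq (blk (Defs.shift (iota' (u' j)) (ext a0 (emb 0) x)))).
  rewrite -[RHS](Ex_marg p_sum1 _ c_inj); apply: eq_Ex => x; apply: eq_bigr => j _.
  by rewrite (blk_loc (lift_box x j)).
have tI : injective (fun w : I' => c + val w) by move=> w w' /addrI /val_inj.
have -> : Ex p (fun x : T -> A => \prod_j lp (x (u j))) =
    Ex p (fun x : I' -> A => \prod_j lp (x (u' j))).
  rewrite -[RHS](Ex_marg p_sum1 _ tI); apply: eq_Ex => x; apply: eq_bigr => j _.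
  by rewrite /= addrC subrK.
have -> : [forall j, u j == u ord0] = [forall j, u' j == u' ord0].
  apply: eq_forallb => j; rewrite -[RHS](inj_eq val_inj) /=.
  by rewrite subr_eq subrK.
rewrite -(Ex_prod_coord_eq u' p_sum1 low).
set X := Ex p _; set Y := Ex p _; set Z := Ex q _.
rewrite (_ : X - Y - (Z - Y) = X - Z); last by ring.
apply: le_trans (moment_bound u' (@emb_inj d n.+2 0) iI' cov lq_le) _.
apply: ler_wpM2l; first by rewrite mulr_ge0 // exprn_ge0 // M_ge0.
have <- : \sum_(j < k.+1) eps = k.+1%:R * eps.
  by rewrite sumr_const card_ord mulr_natl.
apply: ler_sum => j _.
rewrite (transfer_box (K := m) (H := fun x => (bad x)%:R)) //.
  by move=> x x' /bad_loc ->.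
by move=> s sm i; exact: range.
Qed.

(** With [N] sites, expand the powers of [F] and [G] over tuples of sites. By [torus_tuple] only the
    [N] constant tuples see [Delta], so [N * Delta] is close to the difference of the two
    expectations. That difference is small because [F - G] is small in L1 while [F] and [G] are
    bounded by [N * M]. Dividing by [N] leaves [N ^+ k]. *)
Lemma moment_step : `|Delta| <=
  (n.+2%:R ^+ d) ^+ k *
  (k.+1%:R * M ^+ k * (kappa + 2 * M * eps) + 2 * M ^+ k.+1 * (k.+1%:R * eps)).
Proof.
pose N : R := n.+2%:R ^+ d.
have cT : #|{: T}|%:R = N by rewrite card_mx card_ord mul1n natrX.
have N0 : 0 < N by rewrite exprn_gt0.
pose F (x : T -> A) : R := \sum_u lq (blk (lift u x)).
pose G (x : T -> A) : R := \sum_u lp (x u).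
have FG x : F x - G x = torus_discrep x.
  rewrite -sumrB; apply: eq_bigr => u _.
  by rewrite /discrep /lift red0 addr0.
have F_le x : `|F x| <= N * M.
  apply: le_trans (ler_norm_sum _ _ _) _; rewrite -cT mulr_natl -sumr_const.
  by apply: ler_sum => u _; exact: lq_le.
have G_le x : `|G x| <= N * M.
  apply: le_trans (ler_norm_sum _ _ _) _; rewrite -cT mulr_natl -sumr_const.
  by apply: ler_sum => u _; exact: lp_le.
have NM0 : 0 <= N * M by rewrite mulr_ge0 ?M_ge0 // ltW.
have pow_sum (H : T -> R) : (\sum_u H u) ^+ k.+1 =
    \sum_(u : {ffun 'I_k.+1 -> T}) \prod_j H (u j).
  by rewrite -(bigA_distr_bigA (fun _ => H)) prodr_const card_ord.
have EF : Ex p (fun x => F x ^+ k.+1) =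
    \sum_(u : {ffun 'I_k.+1 -> T}) Ex p (fun x => \prod_j lq (blk (lift (u j) x))).
  by rewrite -Ex_sum; apply: eq_Ex => x; rewrite pow_sum.
have EG : Ex p (fun x => G x ^+ k.+1) =
    \sum_(u : {ffun 'I_k.+1 -> T}) Ex p (fun x : T -> A => \prod_j lp (x (u j))).
  by rewrite -Ex_sum; apply: eq_Ex => x; rewrite pow_sum.
(* The constant tuples are the image of the diagonal. *)
have cst : \sum_(u : {ffun 'I_k.+1 -> T}) [forall j, u j == u ord0]%:R = N.
  pose diag (v : T) : {ffun 'I_k.+1 -> T} := [ffun=> v].
  have diagI : injective diag by move=> v w /ffunP/(_ ord0); rewrite !ffunE.
  rewrite -cT -natr_sum -(card_codom diagI) -sum1_card [in RHS]big_mkcond /=.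
  congr _%:R; apply: eq_bigr => u _; congr nat_of_bool.
  apply/forallP/codomP => [H|[v ->] j]; last by rewrite !ffunE.
  by exists (u ord0); apply/ffunP => j; rewrite ffunE; exact/eqP.
have diffpow : `|Ex p (fun x => F x ^+ k.+1) - Ex p (fun x => G x ^+ k.+1)| <=
    N * (kappa + 2 * M * eps) * (k.+1%:R * (N * M) ^+ k).
  rewrite -ExB; apply: le_trans (ler_norm_Ex p_ge0 _) _.
  apply: le_trans (_ : Ex p (fun x => (k.+1%:R * (N * M) ^+ k) * `|torus_discrep x|) <= _).
    apply: ler_Ex => // x; rewrite subrXX FG normrM mulrC; apply: ler_wpM2r => //.
    apply: le_trans (ler_norm_sum _ _ _) _.
    have <- : \sum_(i < k.+1) (N * M) ^+ k = k.+1%:R * (N * M) ^+ k.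
      by rewrite sumr_const card_ord [RHS]mulr_natl.
    apply: ler_sum => i _.
    rewrite normrM !normrX.
    have -> : (N * M) ^+ k = (N * M) ^+ (k.+1.-1 - i) * (N * M) ^+ i.
      by rewrite -exprD; congr (_ ^+ _); have := ltn_ord i; lia.
    apply: ler_pM; rewrite ?exprn_ge0 //.
      by apply: lerXn2r; rewrite ?nnegrE.
    by apply: lerXn2r; rewrite ?nnegrE.
  rewrite ExZ mulrC; apply: ler_wpM2r; last exact: torus_discrep_L1.
  by rewrite mulr_ge0 ?exprn_ge0.
have tup : `|Ex p (fun x => F x ^+ k.+1) - Ex p (fun x => G x ^+ k.+1) - N * Delta| <=
    N ^+ k.+1 * (2 * M ^+ k.+1 * (k.+1%:R * eps)).
  have ND : N * Delta =
      \sum_(u : {ffun 'I_k.+1 -> T}) [forall j, u j == u ord0]%:R * Delta.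
    by rewrite -mulr_suml cst.
  rewrite EF EG ND -!sumrB.
  apply: le_trans (ler_norm_sum _ _ _) _.
  apply: le_trans (ler_sum _ (fun (u : {ffun 'I_k.+1 -> T}) _ => torus_tuple u)) _.
  by rewrite sumr_const card_ffun card_ord -cT -[leLHS]mulr_natl natrX.
rewrite -(ler_pM2l N0).
have -> : N * `|Delta| = `|N * Delta| by rewrite normrM gtr0_norm.
set a := Ex p _ - Ex p _ in diffpow tup.
rewrite (_ : N * Delta = a - (a - N * Delta)); last by ring.
apply: le_trans (ler_normB _ _) _; apply: le_trans (lerD diffpow tup) _.
rewrite exprMn exprS le_eqVlt; apply/orP; left; apply/eqP; rewrite /N; ring.
Qed.

End Torus.

End FiniteModel.

(** * Decay of the errors and conclusion *)

Lemma ler_natXM (R : numDomainType) (d : nat) [a b s : nat] : (a <= b * s)%N ->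
  a%:R ^+ d <= b%:R ^+ d * s%:R ^+ d :> R.
Proof.
by move=> abs; rewrite -exprMn -natrM lerXn2r ?nnegrE ?ler0n // ler_nat.
Qed.

(** Collects the error of [moment_step] for torus side of order [m] and [del = E / 2]. The exponent
    [d * k] comes from the number of sites, and [d.+1] from the bound on [kappa]. *)
Lemma error_decay (R : realType) (d k B : nat) (c C M : R) :
  0 < c -> 0 <= C -> 0 <= M -> (0 < B)%N ->
  exists K : R, forall (m : nat) (kap : R), let E := expR (- (c * m%:R)) in
  0 <= kap ->
  kap <= 4 * (2 * m).+1%:R ^+ d *
    (2 * (E / 2) + (2 * M + ln (B%:R / (E / 2))) * (3 / 2 * (C * E)) +
     2 * M * (C * E)) ->
  (((k + 10) * (2 * m).+1).+2%:R ^+ d) ^+ k *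
    (k.+1%:R * M ^+ k * (kap + 2 * M * (C * E)) +
     2 * M ^+ k.+1 * (k.+1%:R * (C * E))) <=
  K * m.+1%:R ^+ (d * k + d.+1) * E.
Proof.
have a1 m : ((2 * m).+1 <= 2 * m.+1)%N by lia.
have a2 m : (((k + 10) * (2 * m).+1).+2 <= (2 * (k + 11)) * m.+1)%N by nia.
move=> c0 C0 M0 B0.
pose L : R := ln (2 * B%:R).
pose K1 := 1 + (2 * M + L + c) * (3 / 2 * C) + 2 * M * C.
pose V := k.+1%:R * M ^+ k * (4 * 2 ^+ d * K1 + 2 * M * C) +
  2 * M ^+ k.+1 * (k.+1%:R * C).
pose Q : R := (2 * (k + 11))%:R ^+ d.
exists (Q ^+ k * V) => m kap E kap0 kap_le.
have B1 : 1 <= B%:R :> R by rewrite ler1n.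
have E0 : 0 < E by exact: expR_gt0.
have L0 : 0 <= L by rewrite ln_ge0 //; lra.
have MC : 0 <= M * C by rewrite mulr_ge0.
have LC : 0 <= L * C by rewrite mulr_ge0.
have cC : 0 <= c * C by rewrite mulr_ge0 // ltW.
have K1_ge0 : 0 <= K1 by rewrite /K1; nra.
pose s : R := m.+1%:R.
have s1 : 1 <= s by rewrite ler1n.
have s0 : 0 <= s by lra.
have X_le : kap <= 4 * 2 ^+ d * K1 * s ^+ d.+1 * E.
  apply: le_trans kap_le _.
  (* For this [del] the logarithm is linear in [m], which costs one power of [m + 1] beyond the cell
     volume. *)
  have -> : ln (B%:R / (E / 2)) = L + c * m%:R.
    have -> : B%:R / (E / 2) = (2 * B%:R) * expR (c * m%:R).
      by rewrite /E expRN; field; rewrite gt_eqF ?expR_gt0.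
    by rewrite lnM ?posrE ?expR_gt0 ?expRK //; lra.
  have r_le : (2 * m).+1%:R ^+ d <= 2 ^+ d * s ^+ d :> R.
    exact: (ler_natXM R d (a1 m)).
  set r := (2 * m).+1%:R ^+ d in r_le *.
  have r0 : 0 <= r by rewrite exprn_ge0.
  set D := s ^+ d in r_le *.
  have -> : 4 * r * (2 * (E / 2) + (2 * M + (L + c * m%:R)) * (3 / 2 * (C * E)) +
      2 * M * (C * E)) =
    r * (4 * E * (1 + (2 * M + L + c * m%:R) * (3 / 2 * C) + 2 * M * C)) by field.
  have -> : 4 * 2 ^+ d * K1 * s ^+ d.+1 * E = (2 ^+ d * D) * (4 * E * (K1 * s)).
    by rewrite exprSr -/D; ring.
  have ms : m%:R = s - 1 by rewrite /s -[m.+1]addn1 natrD addrK.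
  have m0 : 0 <= m%:R :> R by [].
  have mC : 0 <= m%:R * (c * C) by rewrite mulr_ge0.
  apply: ler_pM => //.
    by apply: mulr_ge0; [lra|nra].
  rewrite ler_pM2l ?mulr_gt0 // /K1.
  have -> : s = m%:R + 1 by lra.
  have mm : 0 <= m%:R * (1 + (2 * M + L) * (3 / 2 * C) + 2 * M * C).
    by apply: mulr_ge0 => //; nra.
  by nra.
have n_le : ((k + 10) * (2 * m).+1).+2%:R ^+ d <= Q * s ^+ d.
  exact: (ler_natXM R d (a2 m)).
have Mk : 0 <= M ^+ k by rewrite exprn_ge0.
have Mk1 : 0 <= M ^+ k.+1 by rewrite exprn_ge0.
have sd1 : 1 <= s ^+ d.+1 by rewrite exprn_ege1.
have Q0 : 0 <= Q by rewrite exprn_ge0.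
rewrite exprD exprM -/s.
have -> : Q ^+ k * V * ((s ^+ d) ^+ k * s ^+ d.+1) * E =
    (Q * s ^+ d) ^+ k * (V * s ^+ d.+1 * E) by rewrite exprMn; ring.
have CE0 : 0 <= C * E by rewrite mulr_ge0 // ltW.
apply: ler_pM.
- by rewrite !exprn_ge0.
- have T1 : 0 <= k.+1%:R * M ^+ k by rewrite mulr_ge0.
  have T2 : 0 <= kap + 2 * M * (C * E) by rewrite addr_ge0 // mulr_ge0 // mulr_ge0.
  have T3 : 0 <= 2 * M ^+ k.+1 * (k.+1%:R * (C * E)).
    by apply: mulr_ge0; apply: mulr_ge0.
  by rewrite addr_ge0 // mulr_ge0.
- by apply: lerXn2r; rewrite ?nnegrE ?mulr_ge0 ?exprn_ge0.
rewrite /V; set X := 4 * 2 ^+ d * K1 in X_le *.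
have E_le : E <= s ^+ d.+1 * E by rewrite ler_peMl // ltW.
have -> : (k.+1%:R * M ^+ k * (X + 2 * M * C) + 2 * M ^+ k.+1 * (k.+1%:R * C)) *
    s ^+ d.+1 * E = k.+1%:R * M ^+ k * (X * s ^+ d.+1 * E + 2 * M * (C * (s ^+ d.+1 * E))) +
    2 * M ^+ k.+1 * (k.+1%:R * (C * (s ^+ d.+1 * E))) by ring.
have CE : C * E <= C * (s ^+ d.+1 * E) by exact: ler_wpM2l.
apply: lerD; apply: ler_wpM2l; rewrite ?mulr_ge0 //.
  by apply: lerD => //; apply: ler_wpM2l; rewrite ?mulr_ge0.
exact: ler_wpM2l.
Qed.

Theorem theorem2 (R : realType) (d : nat) (A B : finType) (a0 : A) (b0 : B)
    (p : A -> R) (q : B -> R)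
    (mu : probability (Cfg d a0) R) (nu : probability (Cfg d b0) R)
    (phi : Cfg d a0 -> Cfg d b0) (c : R) :
  (1 <= d)%N ->
  prob_vec p -> prob_vec q ->
  iid_measure p mu -> iid_measure q nu ->
  entropy p = entropy q ->
  0 < c ->
  factor_map mu nu phi ->
  (exists (C : R) (N : nat), forall n : nat, (N <= n)%N ->
     (mu [set x | (n%:R)%:E < coding_radius mu phi x] <=
        (C * expR (- (c * n%:R)))%:E)%E) ->
  forall r : R, 0 < r ->
    #|[set a : A | p a == r]| = #|[set b : B | q b == r]|.
Proof.
move=> _ [p_ge0 p1] [q_ge0 q1] iidX iidY eqent c0 fac [C [N0 tail]] r r0.
pose h := entropy p.
pose lp a := - ln (p a) - h; pose lq b := - ln (q b) - h.
(* A crude common bound for the four functions [ln p], [lp], [ln q] and [lq]. *)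
pose M := \sum_a (`|ln (p a)| + `|lp a|) + \sum_b (`|ln (q b)| + `|lq b|).
have SA0 (P : pred A) : 0 <= \sum_(a | P a) (`|ln (p a)| + `|lp a|).
  by apply: sumr_ge0 => a _; rewrite addr_ge0.
have SB0 (P : pred B) : 0 <= \sum_(b | P b) (`|ln (q b)| + `|lq b|).
  by apply: sumr_ge0 => b _; rewrite addr_ge0.
have MA a : `|ln (p a)| + `|lp a| <= M.
  by rewrite /M (bigD1 a) //= -addrA lerDl addr_ge0.
have MB b : `|ln (q b)| + `|lq b| <= M.
  by rewrite /M [leRHS]addrC (bigD1 b) //= -addrA lerDl addr_ge0.
have lnp_le a : `|ln (p a)| <= M by apply: le_trans (MA a); rewrite lerDl.
have lnq_le b : `|ln (q b)| <= M by apply: le_trans (MB b); rewrite lerDl.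
have lp_le a : `|lp a| <= M by apply: le_trans (MA a); rewrite lerDr.
have lq_le b : `|lq b| <= M by apply: le_trans (MB b); rewrite lerDr.
have entp : \sum_a p a * lp a = 0.
  under eq_bigr do rewrite /lp mulrBr mulrN.
  by rewrite sumrB sumrN -mulr_suml p1 mul1r subrr.
have entq : \sum_b q b * lq b = 0.
  under eq_bigr do rewrite /lq mulrBr mulrN.
  by rewrite sumrB sumrN -mulr_suml q1 mul1r /h eqent subrr.
have M0 : 0 <= M by apply: le_trans (lp_le a0); rewrite normr_ge0.
have bad_le m : (N0 <= m)%N ->
    @EZ R d A a0 p m (fun x => (bad mu phi m x)%:R) <= C * expR (- (c * m%:R)).
  move=> Nm; have loc x x' : (forall z : 'rV['I_(2 * m).+1]_d,
      x (emb (- m%:Z) z) = x' (emb (- m%:Z) z)) -> bad mu phi m x = bad mu phi m x'.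
    by move=> H; apply: bad_local => i /inball_emb[z <-].
  rewrite /EZ -(prob_local iidX (@emb_inj _ _ _) loc).
  apply: le_trans (bad_coding_radius fac m) _.
  have mu0 : (0 <= mu [set x | (m%:R%:E < coding_radius mu phi x)%E])%E by exact: measure_ge0.
  by move: (tail m Nm) mu0; case: (mu _).
have C0 : 0 <= C.
  have EZ0 : 0 <= @EZ R d A a0 p N0 (fun x => (bad mu phi N0 x)%:R).
    by apply: Ex_ge0 => // x; rewrite ler0n.
  by have := le_trans EZ0 (bad_le N0 (leqnn _)); rewrite pmulr_lge0 // expR_gt0.
have mom k : \sum_a p a * lp a ^+ k = \sum_b q b * lq b ^+ k.
  (* Strong induction: the equality of all lower moments is what [torus_tuple] requires. The zeroth
     moments are the total masses. *)
  elim/ltn_ind: k => -[_|k low].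
    by under eq_bigr do rewrite mulr1; under [RHS]eq_bigr do rewrite mulr1; rewrite p1 q1.
  apply/eqP; rewrite eq_sym -subr_eq0 -normr_le0.
  have B_gt0 : (0 < #|B|)%N by apply/card_gt0P; exists b0.
  have [K HK] := error_decay d k c0 C0 M0 B_gt0.
  apply: (expR_poly_decay (a := (d * k + d.+1)%N) (C := K) (N := N0) c0) => m Nm.
  have E1 : expR (- (c * m%:R)) <= 1.
    by rewrite -expR0 ler_expR oppr_le0 mulr_ge0 // ltW.
  (* The torus side [(k + 10) * (2 m + 1) + 2] is linear in [m], embeds the windows, and leaves room
     to cut between [k + 1] of them. *)
  have mn : (4 * m < ((k + 10) * (2 * m).+1).+2)%N by nia.
  have kn : (k.+1 * (2 * m) < ((k + 10) * (2 * m).+1).+2)%N by nia.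
  (* Taking [del] to be half the exponential makes it exponentially small and at most 1/2 for every
     [m]. *)
  have del0 : 0 < expR (- (c * m%:R)) / 2 by rewrite divr_gt0 // expR_gt0.
  have del2 : expR (- (c * m%:R)) / 2 <= 2^-1 by lra.
  have coup := coupling_exists iidX iidY fac m.
  have blk_loc := blk_local mu phi (m := m).
  have bad_loc := bad_local mu phi (m := m).
  have kap := kappa_bound (b0 := b0) p_ge0 p1 q_ge0 q1 blk_loc bad_loc coup lnp_le lnq_le
    entp entq lq_le (bad_le m Nm) del0 del2.
  apply: le_trans (moment_step (b0 := b0) p_ge0 p1 q1 blk_loc bad_loc coup entp entq
    lp_le lq_le (bad_le m Nm) mn kn low) _.
  by apply: HK kap; apply: Ex_ge0.
have := moments_card_eq mom (- ln r - h).
(* The mass at the value [- ln r - h] comes exactly from the symbols of probability [r]. Since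
   [ln 0 = 0], symbols of probability zero may also meet the condition, when [r = 1], but they carry
   no mass. *)
have side (T : finType) (w : T -> R) : (forall t, 0 <= w t) ->
    \sum_(t | - ln (w t) - h == - ln r - h) w t = #|[set t | w t == r]|%:R * r.
  move=> w0; rewrite mulr_natl -sumr_const (bigID (fun t => w t == 0)) /= big1 ?add0r.
    have E t : (- ln (w t) - h == - ln r - h) && (w t != 0) -> w t = r.
      move=> /andP[/eqP /addIr /oppr_inj wr wt].
      by apply: ln_inj; rewrite ?posrE // lt0r wt w0.
    apply: eq_big => [t|t /E //]; apply/idP/idP => [/E wr|]; first by rewrite inE /= wr.
    by rewrite inE => /eqP ->; rewrite eqxx gt_eqF.
  by move=> t /andP[_ /eqP].
rewrite /lp /lq !side // => /(mulIf (lt0r_neq0 r0)) /eqP.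
by rewrite eqr_nat => /eqP.
Qed.
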